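(* In the setting below, let $\vartheta^*$ be the optimal value of $\min_{u\in U}G(u)$ and, for each $N$, let $u_N^*:\Omega\to U$ be a measurable map such that $u_N^*(\omega)$ solves the SAA problem $\min_{u\in U}\hat F_N(Bu,\omega)+\psi(u)$ for every $\omega$. Then (i) $\hat\vartheta_N^*\to\vartheta^*$ as $N\to\infty$ with probability one, and (ii) for almost all $\omega\in\Omega$, the sequence $(u_N^*(\omega))$ has at least one weak accumulation point in $U$, and every such point is a solution of $\min_{u\in U}G(u)$.
   Context: Let $U$ be a separable Hilbert space (identified with its dual), $W$ a separable Banach space, and $B:U\to W$ a compact linear operator. Let $\psi:U\to[0,\infty]$ be proper, closed and convex with bounded domain $\mathcal D(\psi)=\{u\in U:\psi(u)<\infty\}$. Let $U_0\subset U$ be open, convex and bounded with $\mathcal D(\psi)\subset U_0$. Let $\Xi$ be a complete separable metric space (with Borel $\sigma$-field), $\boldsymbol\xi$ a $\Xi$-valued random element, and $\boldsymbol\xi^1,\boldsymbol\xi^2,\ldots$ independent $\Xi$-valued random elements defined on a complete probability space $(\Omega,\mathcal F,P)$, each having the distribution of $\boldsymbol\xi$. Let $f:B(U_0)\times\Xi\to\mathbb R$ be such that $f(\cdot,\xi)$ is continuous on $B(\mathcal D(\psi))$ for each $\xi\in\Xi$, $f(w,\cdot)$ is measurable for each $w\in B(U_0)$, and $|f(Bu,\xi)|\le \zeta_f(\xi)$ for all $(u,\xi)\in U_0\times\Xi$, where $\zeta_f:\Xi\to[0,\infty)$ is integrable. Set $F(w)=\mathbb E[f(w,\boldsymbol\xi)]$,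 $G(u)=F(Bu)+\psi(u)$, $\hat F_N(w,\omega)=\frac1N\sum_{i=1}^N f(w,\boldsymbol\xi^i(\omega))$, and let $\hat\vartheta_N^*(\omega)$ denote the optimal value of the SAA problem $\min_{u\in U}\hat F_N(Bu,\omega)+\psi(u)$. *)

(* Defs.v *)
From HB Require Import structures.
From mathcomp Require Import all_boot all_order all_algebra.
From mathcomp Require Import all_classical all_reals all_analysis.
Set Implicit Arguments. Unset Strict Implicit. Unset Printing Implicit Defensive.
Import Order.TTheory GRing.Theory Num.Theory.
Import numFieldNormedType.Exports.
Local Open Scope classical_set_scope.
Local Open Scope ring_scope.

Definition separable_space (T : topologicalType) : Prop :=
  exists D : set T, countable D /\ dense D.

(* [inner] is an inner product on the (complete) normed space U inducing
   its norm: U is then a (real) Hilbert space. *)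
Definition hilbert_inner (R : realType) (U : normedModType R)
  (inner : U -> U -> R) : Prop :=
  [/\ (forall u v, inner u v = inner v u),
      (forall (a : R) u v w, inner (a *: u + v) w = a * inner u w + inner v w)
    & (forall u, `|u| ^+ 2 = inner u u)].

Definition compact_operator (R : realType) (U W : normedModType R)
  (B : U -> W) : Prop :=
  forall A : set U, bounded_set A -> compact (closure (B @` A)).

Definition convex_efun (R : realType) (U : normedModType R)
  (psi : U -> \bar R) : Prop :=
  forall (t : R) u v, 0 <= t <= 1 ->
    (psi (t *: u + (1 - t) *: v)%R <= t%:E * psi u + (1 - t)%:E * psi v)%E.

Definition edom (R : realType) (U : Type) (psi : U -> \bar R) : set U :=
  [set u | (psi u < +oo)%E].

Definition borel_measurable_map d (Om : measurableType d) (T : topologicalType)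
  (g : Om -> T) : Prop :=
  forall O : set T, open O -> measurable (g @^-1` O).

Definition mutually_independent d (Om : measurableType d) (R : realType)
  (P : probability Om R) d' (X : measurableType d') (xs : nat -> Om -> X) : Prop :=
  forall (s : seq nat) (A : nat -> set X), uniq s ->
    (forall i, measurable (A i)) ->
    P (\bigcap_(i in [set` s]) (xs i @^-1` A i)) =
    (\prod_(i <- s) P (xs i @^-1` A i))%E.

Definition same_distribution d (Om : measurableType d) (R : realType)
  (P : probability Om R) d' (X : measurableType d') (x y : Om -> X) : Prop :=
  forall A : set X, measurable A -> P (x @^-1` A) = P (y @^-1` A).

Definition weak_cvg (R : realType) (U : Type) (inner : U -> U -> R)
  (v : nat -> U) (x : U) : Prop :=
  forall w, (fun k => inner (v k) w) @ \oo --> inner x w.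

Definition weak_acc_point (R : realType) (U : Type) (inner : U -> U -> R)
  (v : nat -> U) (x : U) : Prop :=
  exists phi : nat -> nat, (forall k, (phi k < phi k.+1)%N) /\
    weak_cvg inner (v \o phi) x.

Definition expF d (Om : measurableType d) (R : realType) (P : probability Om R)
  (Xi W : Type) (f : W -> Xi -> R) (xi : Om -> Xi) (w : W) : R :=
  Rintegral P setT (fun om => f w (xi om)).

Definition objG d (Om : measurableType d) (R : realType) (P : probability Om R)
  (Xi U W : Type) (f : W -> Xi -> R) (xi : Om -> Xi) (B : U -> W)
  (psi : U -> \bar R) (u : U) : \bar R :=
  ((expF P f xi (B u))%:E + psi u)%E.

Definition saa_obj (Om : Type) (R : realType) (Xi U W : Type)
  (f : W -> Xi -> R) (xis : nat -> Om -> Xi) (B : U -> W) (psi : U -> \bar R)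
  (N : nat) (om : Om) (u : U) : \bar R :=
  ((N%:R^-1 * \sum_(i < N) f (B u) (xis i om))%:E + psi u)%E.

(* Main.v *)
Require Import Defs.
From HB Require Import structures.
From mathcomp Require Import all_boot all_order all_algebra.
From mathcomp Require Import all_classical all_reals all_analysis.
From mathcomp Require Import measurable_realfun ring lra.
Set Implicit Arguments. Unset Strict Implicit. Unset Printing Implicit Defensive.
Import Order.TTheory GRing.Theory Num.Theory.
Import numFieldNormedType.Exports.
Local Open Scope classical_set_scope.
Local Open Scope ring_scope.

(** The sample averages epi-converge almost surely.  Cover [B (dom psi)] by
    countably many small balls; the infimum of [f(., xi)] over such a ball is a
    measurable function dominated by [zeta], so the strong law of large numbers
    applies to all these infima at once and, with dominated convergence as the
    radius shrinks, yields a uniform local lower bound for the empirical means.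
    Only pointwise convergence along a minimizing sequence is needed for the
    upper bound.  Boundedness of [dom psi] gives weak limits of the SAA solutions,
    convexity makes [psi] weakly lower semicontinuous, and compactness of [B]
    turns weak convergence into strong convergence in [W].

    The strong law is proved along Etemadi's lines, with truncation at the sample
    size, on integer sequences of geometric growth.  Weak limits are taken along
    ultrafilters, so that subsequences appear only in the final extraction of a
    weak accumulation point. *)

(** * Strong law of large numbers *)

Section iid.
Context d d' (Om : measurableType d) (X : measurableType d') (R : realType).
Variables (P : probability Om R) (xi : {mfun Om >-> X}).
Variable xis : nat -> {mfun Om >-> X}.
Hypothesis indep : mutually_independent P xis.
Hypothesis idist : forall i, same_distribution P (xis i) xi.

Lemma iid_integral (g : X -> \bar R) i : measurable_fun setT g ->
  (forall x, 0 <= g x)%E ->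
  (\int[P]_om g (xis i om) = \int[P]_om g (xi om))%E.
Proof.
move=> mg g0.
rewrite -(ge0_integral_distribution (xis i : {RV P >-> X}) mg g0).
rewrite -(ge0_integral_distribution (xi : {RV P >-> X}) mg g0).
by apply: eq_measure_integral => A mA _; exact: idist.
Qed.

Lemma indep_measure2 i j (A B : set X) : i != j -> measurable A -> measurable B ->
  (P (xis i @^-1` A `&` xis j @^-1` B) = P (xi @^-1` A) * P (xi @^-1` B))%E.
Proof.
move=> ij mA mB.
have := @indep [:: i; j] (fun n => if n == i then A else B).
rewrite /= inE ij => /(_ isT) h.
rewrite -(idist i mA) -(idist j mB).
have {h} := h (fun n => match n == i as b return
  measurable (if b then A else B) with true => mA | false => mB end).
rewrite !big_cons big_nil eqxx eq_sym (negbTE ij) mule1 => <-.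
congr (P _); apply/seteqP; split => [om [Ai Bj] n /=|om h].
  by rewrite !inE => /orP[/eqP ->|/eqP ->]; rewrite ?eqxx// eq_sym (negbTE ij).
split.
  by have := h i; rewrite /= eqxx !inE eqxx; exact.
by have := h j; rewrite /= eq_sym (negbTE ij) !inE eqxx orbT; exact.
Qed.

(** The law of the pair agrees with the product of the marginal laws on rectangles by
    [indep_measure2], hence everywhere by uniqueness of the product measure; Tonelli then factors
    the integral. *)
Lemma indep_integralM (g1 g2 : X -> R) i j : i != j ->
  measurable_fun setT g1 -> measurable_fun setT g2 ->
  (forall x, 0 <= g1 x) -> (forall x, 0 <= g2 x) ->
  (\int[P]_om (g1 (xis i om) * g2 (xis j om))%:E =
   \int[P]_om (g1 (xi om))%:E * \int[P]_om (g2 (xi om))%:E)%E.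
Proof.
move=> ij mg1 mg2 g10 g20.
have mpsi : measurable_fun setT (fun om => (xis i om, xis j om)).
  by apply: measurable_fun_pair.
pose psi : {RV P >-> (X * X)%type} :=
  HB.pack (fun om => (xis i om, xis j om)) (isMeasurableFun.Build _ _ _ _ _ mpsi).
pose mu : probability X R := distribution P (xi : {RV P >-> X}).
have mG : measurable_fun setT (fun z : X * X => (g1 z.1 * g2 z.2)%:E).
  by apply/measurable_EFinP; apply: measurable_funM; apply: measurableT_comp.
have G0 (z : X * X) : (0 <= (g1 z.1 * g2 z.2)%:E)%E by rewrite lee_fin mulr_ge0.
transitivity (\int[distribution P psi]_z (g1 z.1 * g2 z.2)%:E)%E.
  by rewrite ge0_integral_distribution.
transitivity (\int[(mu \x mu)%E]_z (g1 z.1 * g2 z.2)%:E)%E.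
  apply: eq_measure_integral => A mA _; apply/esym.
  apply: product_measure_unique => // B C mB mC.
  exact: indep_measure2.
rewrite fubini_tonelli1// /fubini_F /=.
have mg1E : measurable_fun setT (fun x => (g1 x)%:E) by exact/measurable_EFinP.
have mg2E : measurable_fun setT (fun x => (g2 x)%:E) by exact/measurable_EFinP.
have inner_int x : (\int[mu]_y (g1 x * g2 y)%:E =
    (g1 x)%:E * \int[mu]_y (g2 y)%:E)%E.
  under eq_integral do rewrite EFinM.
  by rewrite ge0_integralZl ?lee_fin// => y _; rewrite lee_fin.
under eq_integral do rewrite inner_int.
have g1E0 x : [set: X] x -> (0 <= (g1 x)%:E)%E by rewrite lee_fin.
rewrite ge0_integralZr//; last by apply: integral_ge0 => x _; rewrite lee_fin.
by rewrite !ge0_integral_distribution//; exact/measurable_EFinP.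
Qed.

End iid.

(** * Geometric subsequences and interpolation between them *)

(* Integer sequence growing geometrically with ratio between [1 + 1/(p+1)] and
   [1 + 2/(p+1)]. *)
Fixpoint geo (p n : nat) : nat :=
  if n is n'.+1 then (geo p n' + geo p n' %/ p.+1).+1 else p.+1.

Lemma geo_gt p n : (p < geo p n)%N.
Proof.
by elim: n => [//|n /leq_trans]; apply; rewrite /= -addnS leq_addr.
Qed.

Lemma geo_ltS p n : (geo p n < geo p n.+1)%N.
Proof. by rewrite /= ltnS leq_addr. Qed.

Lemma geo_ge p n : (n < geo p n)%N.
Proof. by elim: n => [//|n IH]; exact: leq_trans (geo_ltS p n). Qed.

Lemma geo_lower p n : (geo p n <= p.+1 * (geo p n.+1 - geo p n))%N.
Proof.
rewrite /= -addnS addKn mulnC; apply: ltnW.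
by rewrite ltn_ceil.
Qed.

(** The quotient term and the successor, each multiplied by [p.+1], cost at most one extra
    [geo p n]; for the successor this is [geo_gt]. *)
Lemma geo_upper p n : (p.+1 * geo p n.+1 <= p.+3 * geo p n)%N.
Proof.
rewrite /= -addnS mulnDr mulnS.
have -> : (p.+3 * geo p n = p.+1 * geo p n + (geo p n + geo p n))%N.
  by rewrite addnA -2!mulSnr.
by rewrite leq_add2l leq_add ?geo_gt// mulnC leq_trunc_div.
Qed.

Lemma geo_bracket p n0 N : (geo p n0 <= N)%N ->
  exists n, [/\ (n0 <= n)%N, (geo p n <= N)%N & (N < geo p n.+1)%N].
Proof.
elim: N => [|N IH]; first by rewrite leqNgt (leq_trans _ (geo_gt p n0)).
rewrite leq_eqVlt => /predU1P[<-|]; first by exists n0; rewrite geo_ltS.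
rewrite ltnS => /IH[n [n0n gn Ng]].
have [Ng'|] := ltnP N.+1 (geo p n.+1); first by exists n; rewrite leqW.
move=> Ng'; exists n.+1; split => //; first exact: leqW.
by apply: leq_ltn_trans Ng (geo_ltS _ _).
Qed.

Section geo_real.
Context {R : realType}.

(** The bound is uniform in [M] and linear in [x]: integrated at [x = h (xi om)], it makes the
    deviation probabilities along [geo p] summable under a first moment alone. *)
Lemma geo_trunc_sum p (x : R) M : 0 <= x ->
  \sum_(n < M) (Num.min x (geo p n)%:R) ^+ 2 / (geo p n)%:R <= 4 * p.+2%:R * x.
Proof.
rewrite le_eqVlt => /predU1P[<-|x0].
  rewrite big1 ?mulr0// => n _; rewrite min_l ?ler0n//.
  by rewrite expr0n/= mul0r.
have g0 n : 0 < (geo p n)%:R :> R by rewrite ltr0n (leq_ltn_trans _ (geo_gt p n)).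
pose H n : R := x * (geo p n)%:R / (x + (geo p n)%:R).
(* The sum telescopes against the increasing bounded function
   [k |-> x k / (x + k)]. *)
have step n : (Num.min x (geo p n)%:R) ^+ 2 / (geo p n)%:R <=
    4 * p.+2%:R * (H n.+1 - H n).
  set k : R := (geo p n)%:R; set k' : R := (geo p n.+1)%:R.
  have k0 : 0 < k := g0 n; have k'0 : 0 < k' := g0 n.+1.
  have hk : k <= p.+1%:R * (k' - k).
    by rewrite -natrB ?(ltnW (geo_ltS _ _))// -natrM ler_nat geo_lower.
  have kk' : k < k' by rewrite ltr_nat geo_ltS.
  have xk : 0 < x + k by exact: addr_gt0.
  have xk' : 0 < x + k' by exact: addr_gt0.
  (* The minimum is at most the harmonic mean, which has the denominator occurring in [H]. *)
  have hmin : Num.min x k <= 2 * x * k / (x + k).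
    rewrite ler_pdivlMr//; have [xk1|kx] := leP x k; nra.
  have m0 : 0 <= Num.min x k by rewrite le_min !ltW.
  apply: (@le_trans _ _ ((2 * x * k / (x + k)) ^+ 2 / k)).
    by rewrite ler_pM2r ?invr_gt0// ler_pXn2r// ?nnegrE// (le_trans m0).
  have -> : (2 * x * k / (x + k)) ^+ 2 / k = 4 * x ^+ 2 / (x + k) * (k / (x + k)).
    by field; rewrite !gt_eqF.
  have -> : 4 * p.+2%:R * (H n.+1 - H n) =
      4 * x ^+ 2 / (x + k) * (p.+2%:R * (k' - k) / (x + k')).
    by rewrite /H -/k -/k'; field; rewrite !gt_eqF.
  apply: ler_wpM2l; first by rewrite divr_ge0 ?mulr_ge0 ?sqr_ge0// ltW.
  rewrite ler_pdivrMr// mulrAC ler_pdivlMr//.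
  (* Of the [p.+2] copies of [k' - k], [p.+1] dominate [k] and the last one turns [k * k] into
     [k * k']. *)
  rewrite -[p.+2%:R]natr1; move: (p.+1%:R : R) hk => q hk; nra.
apply: (@le_trans _ _ (\sum_(n < M) 4 * p.+2%:R * (H n.+1 - H n))).
  by apply: ler_sum.
rewrite -mulr_sumr -(big_mkord predT (fun n => H n.+1 - H n)) telescope_sumr//.
apply: ler_wpM2l; first by rewrite mulr_ge0.
have H0 : 0 <= H 0%N by rewrite divr_ge0 ?mulr_ge0 ?addr_ge0 ?ltW.
rewrite lerBlDr (@le_trans _ _ x)// ?lerDl// /H ler_pdivrMr ?addr_gt0//.
by rewrite mulrDr lerDr mulr_ge0 ?ltW.
Qed.

(** Monotonicity squeezes [S N] between its values at consecutive terms of [geo p]; changing the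
    denominator costs a factor at most [1 + 2 / p.+1], which is close to 1 for large [p]. *)
Lemma geo_interpolation (S : nat -> R) (m : R) :
  (forall n, 0 <= S n) -> {homo S : n k / (n <= k)%N >-> n <= k} ->
  (forall p, (fun n => S (geo p n) / (geo p n)%:R) @ \oo --> m) ->
  (fun N => S N / N%:R) @ \oo --> m.
Proof.
move=> S0 Snd Sm.
have m0 : 0 <= m.
  apply: (closed_cvg [set r : R | 0 <= r]) (Sm 0%N); first exact: closed_ge.
  by apply: nearW => n /=; rewrite divr_ge0.
apply/cvgrPdist_le => e e0.
(* With this [p] the factor [1 + 2 * eta] moves [m] by at most [e / 4] and [e / 4] by at most
   [e / 2], within the total error [e]. *)
have [p _ /(_ p (leqnn p)) /= hp] : \forall p \near \oo,
    p.+1%:R^-1 < Num.min 1 (e / (8 * (m + 1))) :> R.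
  have /cvgr_lt := @cvg_harmonic R; apply.
  by rewrite lt_min ltr01 divr_gt0// mulr_gt0// ltr_wpDl.
have {hp} [hp1 hp2] : p.+1%:R^-1 <= 1 :> R /\ p.+1%:R^-1 * (8 * (m + 1)) <= e.
  move: hp; rewrite lt_min => /andP[/ltW -> h]; split => //.
  by rewrite -ler_pdivlMr ?mulr_gt0 ?ltr_wpDl// ltW.
have e40 : 0 < e / 4 by rewrite divr_gt0.
have /cvgrPdist_le/(_ _ e40)[n0 _ hn0] := Sm p.
exists (geo p n0) => // N /= /geo_bracket[n [n0n gn Ng]].
have := hn0 n n0n; have := hn0 n.+1 (leqW n0n) => /=.
set k : R := (geo p n)%:R; set k' : R := (geo p n.+1)%:R.
have k0 : 0 < k by rewrite ltr0n (leq_ltn_trans _ (geo_gt p n)).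
have k'0 : 0 < k' by rewrite ltr0n (leq_ltn_trans _ (geo_gt p n.+1)).
have kN : k <= N%:R by rewrite ler_nat.
have Nk' : N%:R <= k' by rewrite ler_nat ltnW.
have N0 : 0 < N%:R :> R by exact: lt_le_trans kN.
have k'k : k' <= (1 + 2 * p.+1%:R^-1) * k.
  rewrite -(@ler_pM2l _ p.+1%:R)// mulrA mulrDr mulr1 mulrCA divff// mulr1.
  by rewrite -natrD addn2 -!natrM ler_nat geo_upper.
have SN1 : S (geo p n) <= S N by exact: Snd.
have SN2 : S N <= S (geo p n.+1) by apply: Snd; exact: ltnW.
move: hp1 hp2 k'k; have : 0 < p.+1%:R^-1 :> R by rewrite invr_gt0.
move: (p.+1%:R^-1) => eta eta0 hp1 hp2 k'k.
rewrite !ler_distl => /andP[a1 _] /andP[_ b2].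
have {a1} a1 : S (geo p n.+1) <= (m + e / 4) * k'.
  by rewrite -ler_pdivrMr// -lerBlDr.
have {b2} b2 : (m - e / 4) * k <= S (geo p n).
  by rewrite -ler_pdivlMr// lerBlDr.
have etam : eta * m <= e / 8 by nra.
apply/andP; split; [rewrite lerBlDr ler_pdivrMr//|rewrite -lerBlDr ler_pdivlMr//].
  apply: (le_trans SN2); apply: (le_trans a1).
  apply: (@le_trans _ _ ((m + e / 4) * (1 + 2 * eta) * N%:R)).
    rewrite -mulrA; apply: ler_wpM2l; first by rewrite addr_ge0// ltW.
    by apply: (le_trans k'k); rewrite ler_wpM2l// addr_ge0// mulr_ge0// ltW.
  by apply: ler_wpM2r; [exact: ltW|nra].
(* The lower bound is trivial when [m <= e]; otherwise [m - e] is positive and may multiply the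
   ratio estimate. *)
have [me|me] := leP m e.
  by rewrite (le_trans _ (S0 N))// mulr_le0_ge0 ?subr_le0// ltW.
apply: le_trans SN1; apply: le_trans b2.
apply: (@le_trans _ _ ((m - e) * (1 + 2 * eta) * k)).
  rewrite -mulrA; apply: ler_wpM2l; first by rewrite subr_ge0 ltW.
  exact: le_trans k'k.
by apply: ler_wpM2r; [exact: ltW|nra].
Qed.

End geo_real.

(** * Integrability, finite sums and Markov's inequality *)

Section probability_lemmas.
Context d (Om : measurableType d) (R : realType) (P : probability Om R).

Lemma bounded_integrable (g : Om -> R) (M : R) : measurable_fun setT g ->
  (forall om, `|g om| <= M) -> P.-integrable setT (EFin \o g).
Proof.
move=> mg gM; apply: (@le_integrable _ _ _ P _ measurableT _ (EFin \o cst M)).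
- exact/measurable_EFinP.
- move=> om _ /=; rewrite lee_fin (le_trans (gM om))//.
  by rewrite ger0_norm// (le_trans _ (gM om)).
- exact: finite_measure_integrable_cst.
Qed.

Lemma Rintegral_sum n (g : nat -> Om -> R) :
  (forall i, P.-integrable setT (EFin \o g i)) ->
  P.-integrable setT (EFin \o (fun om => \sum_(i < n) g i om)) /\
  \int[P]_om (\sum_(i < n) g i om) = \sum_(i < n) \int[P]_om g i om.
Proof.
move=> ig; elim: n => [|n [IH1 IH2]].
  split.
    have -> : EFin \o (fun om => \sum_(i < 0) g i om) = cst 0%E.
      by apply/funext => om /=; rewrite big_ord0.
    exact: integrable0.
  under eq_Rintegral do rewrite big_ord0.
  by rewrite big_ord0 Rintegral_cst// mul0r.
split.
  have h := integrableD measurableT IH1 (ig n).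
  apply: (eq_integrable measurableT _ _ _ h) => om _ /=.
  by rewrite big_ord_recr.
under eq_Rintegral do rewrite big_ord_recr/=.
by rewrite RintegralD// IH2 big_ord_recr.
Qed.

Lemma markov_Rintegral (g : Om -> R) (c : R) : 0 < c ->
  P.-integrable setT (EFin \o g) -> (forall om, 0 <= g om) ->
  (P [set om | (c <= g om)%R] <= (c^-1 * \int[P]_om g om)%:E)%E.
Proof.
move=> c0 ig g0.
have mg := measurable_int P ig.
have := le_integral_abse P measurableT mg c0; rewrite setTI.
have -> : (\int[P]_x `|(EFin \o g) x| = (\int[P]_om g om)%:E)%E.
  rewrite /Rintegral fineK ?integrable_fin_num//.
  by apply: eq_integral => om _ /=; rewrite ger0_norm.
have -> : [set x | (c%:E <= `|(EFin \o g) x|)%E] = [set om | c <= g om].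
  by apply/seteqP; split => om /=; rewrite lee_fin ger0_norm.
by rewrite EFinM lee_pdivlMl.
Qed.

End probability_lemmas.

(** * Variance of a sum of bounded samples *)

Section slln.
Context d d' (Om : measurableType d) (X : measurableType d') (R : realType).
Variables (P : probability Om R) (xi : {mfun Om >-> X}).
Variable xis : nat -> {mfun Om >-> X}.
Hypothesis indep : mutually_independent P xis.
Hypothesis idist : forall i, same_distribution P (xis i) xi.

Lemma iid_Rintegral (g : X -> R) i : measurable_fun setT g ->
  (forall x, 0 <= g x) -> \int[P]_om g (xis i om) = \int[P]_om g (xi om).
Proof.
move=> mg g0; congr fine.
apply: (iid_integral idist (g := EFin \o g)) => //; first exact/measurable_EFinP.
Qed.

Section bounded.
Variables (t : X -> R) (K : R).
Hypotheses (mt : measurable_fun setT t) (t0 : forall x, 0 <= t x).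
Hypothesis tK : forall x, t x <= K.

Let m := \int[P]_om t (xi om).
Let q := \int[P]_om (t (xi om)) ^+ 2.

Let mti i : measurable_fun setT (fun om => t (xis i om)).
Proof. exact: measurableT_comp. Qed.

Let tn x : `|t x| <= K. Proof. by rewrite ger0_norm. Qed.

Let it i : P.-integrable setT (EFin \o (fun om => t (xis i om))).
Proof. exact: (@bounded_integrable _ _ _ P _ K). Qed.

Let itt i j :
  P.-integrable setT (EFin \o (fun om => t (xis i om) * t (xis j om))).
Proof.
apply: (@bounded_integrable _ _ _ P _ (K * K)); first exact: measurable_funM.
by move=> om; rewrite normrM ler_pM.
Qed.

Let iZ (a : R) i : P.-integrable setT (EFin \o (fun om => a * t (xis i om))).
Proof.
apply: (@bounded_integrable _ _ _ P _ (`|a| * K)); first exact: measurable_funM.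
by move=> om; rewrite normrM ler_pM.
Qed.

Let ic (a : R) : P.-integrable setT (EFin \o (fun _ : Om => a)).
Proof. exact: (@finite_measure_integrable_cst _ _ _ P _ a measurableT). Qed.

Let iD (f g : Om -> R) : P.-integrable setT (EFin \o f) ->
  P.-integrable setT (EFin \o g) ->
  P.-integrable setT (EFin \o (fun om => f om + g om)).
Proof. by move=> fi gi; exact: (integrableD measurableT fi gi). Qed.

Let s i om := t (xis i om) - m.

Let s2E i j : (fun om => s i om * s j om) = (fun om =>
  (t (xis i om) * t (xis j om) + (- m) * t (xis i om)) +
  ((- m) * t (xis j om) + m ^+ 2)).
Proof. by apply/funext => om; rewrite /s; ring. Qed.

Let is2 i j : P.-integrable setT (EFin \o (fun om => s i om * s j om)).
Proof. by rewrite s2E; apply: iD; exact: iD. Qed.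

Let int_s2 i j : \int[P]_om (s i om * s j om) =
  \int[P]_om (t (xis i om) * t (xis j om)) - m ^+ 2.
Proof.
rewrite s2E.
have h1 := iD (itt i j) (iZ (- m) i); have h2 := iD (iZ (- m) j) (ic (m ^+ 2)).
rewrite (RintegralD measurableT h1 h2).
rewrite (RintegralD measurableT (itt i j) (iZ (- m) i)).
rewrite (RintegralD measurableT (iZ (- m) j) (ic (m ^+ 2))).
rewrite (RintegralZl _ measurableT (it i)) (RintegralZl _ measurableT (it j)).
rewrite !iid_Rintegral//.
have PT : fine (P [set: Om]) = 1 by rewrite probability_setT.
by rewrite (Rintegral_cst P measurableT) PT -/m; ring.
Qed.

(** After expanding the square, the off-diagonal terms are covariances and vanish by independence,
    while each diagonal term is a variance, at most the second moment [q]. The estimate does not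
    involve [K], so the truncation level may grow with [k]. *)
Lemma iid_variance_sum k :
  P.-integrable setT (EFin \o (fun om => (\sum_(i < k) s i om) ^+ 2)) /\
  \int[P]_om (\sum_(i < k) s i om) ^+ 2 <= k%:R * q.
Proof.
have E : (fun om => (\sum_(i < k) s i om) ^+ 2) =
    (fun om => \sum_(i < k) \sum_(j < k) s i om * s j om).
  by apply/funext => om; rewrite expr2 big_distrlr.
rewrite E.
have h i := @Rintegral_sum _ _ _ P k (fun j om => s i om * s j om) (is2 i).
have h2 := @Rintegral_sum _ _ _ P k (fun i om => \sum_(j < k) s i om * s j om)
  (fun i => (h i).1).
split; first exact: h2.1.
rewrite h2.2; under eq_bigr do rewrite (h _).2.
have -> : k%:R * q = \sum_(i < k) q by rewrite sumr_const card_ord mulr_natl.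
apply: ler_sum => i _; rewrite (bigD1 i)//= big1 ?addr0.
  rewrite int_s2 lerBlDr.
  under eq_Rintegral do rewrite -expr2.
  rewrite (@iid_Rintegral (fun x => t x ^+ 2)); last 2 first.
  - exact: measurable_funX.
  - by move=> x; exact: sqr_ge0.
  by rewrite lerDl sqr_ge0.
move=> j ji; rewrite int_s2 /Rintegral (indep_integralM indep idist)//; last first.
  by rewrite eq_sym.
have ix : P.-integrable setT (EFin \o (fun om => t (xi om))).
  by apply: (@bounded_integrable _ _ _ P _ K) => //; exact: measurableT_comp.
by rewrite fineM ?integrable_fin_num// -expr2 subrr.
Qed.

End bounded.

End slln.

(** * The strong law for nonnegative functions *)

Section slln_nonneg.
Context d d' (Om : measurableType d) (X : measurableType d') (R : realType).
Variables (P : probability Om R) (xi : {mfun Om >-> X}).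
Variable xis : nat -> {mfun Om >-> X}.
Hypothesis indep : mutually_independent P xis.
Hypothesis idist : forall i, same_distribution P (xis i) xi.
Variable h : X -> R.
Hypotheses (mh : measurable_fun setT h) (h0 : forall x, 0 <= h x).
Hypothesis ih : P.-integrable setT (EFin \o (fun om => h (xi om))).

Let S n om : R := \sum_(i < n) h (xis i om).
(** All of the first [k] samples are truncated at the same level [k], so the truncated ones remain
    identically distributed. *)
Let t k x : R := Num.min (h x) k%:R.
Let m k := \int[P]_om t k (xi om).
Let q k := \int[P]_om (t k (xi om)) ^+ 2.

Let mt k : measurable_fun setT (t k).
Proof. exact: measurable_minr. Qed.

Let t0 k x : 0 <= t k x. Proof. by rewrite le_min h0 ler0n. Qed.

Let tk k x : t k x <= k%:R. Proof. by rewrite ge_min lexx orbT. Qed.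

Let it2 k (y : {mfun Om >-> X}) :
  P.-integrable setT (EFin \o (fun om => t k (y om) ^+ 2)).
Proof.
apply: (@bounded_integrable _ _ _ P _ (k%:R ^+ 2)).
  by apply: measurable_funX; exact: measurableT_comp.
by move=> om; rewrite ger0_norm ?sqr_ge0// ler_pXn2r// nnegrE.
Qed.

Let mS n : measurable_fun setT (S n).
Proof. by apply: measurable_sum => i; exact: measurableT_comp. Qed.

Let dev k (e : R) := [set om | e <= `|S k om / k%:R - m k|].

Let mdev k e : measurable (dev k e).
Proof.
have mg : measurable_fun setT (fun om => `|S k om / k%:R - m k|).
  apply: measurableT_comp => //; apply: measurable_funB => //.
  by apply: measurable_funM.
have := mg measurableT `[e, +oo[%classic (measurable_itv _).
rewrite setTI; congr measurable; apply/seteqP; split => om /=;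
  by rewrite in_itv/= andbT.
Qed.

Let iZ (a : R) (g : Om -> R) : P.-integrable setT (EFin \o g) ->
  P.-integrable setT (EFin \o (fun om => a * g om)).
Proof. by move=> ig; exact: (integrableZl measurableT a ig). Qed.

(** On a deviation, either some sample reaches the truncation level, and then the [t2] term of [G]
    is at least 1, or no truncation occurs and the [s2] term is at least 1. Markov's inequality for
    [G] covers both cases at once. *)
Let weak_law k (e : R) : (0 < k)%N -> 0 < e ->
  (P (dev k e) <= ((1 + e ^- 2) * (q k / k%:R))%:E)%E.
Proof.
move=> k0 e0.
have kR : 0 < k%:R :> R by rewrite ltr0n.
have [ivar var] := iid_variance_sum indep idist (mt k) (t0 k) (tk k) k.
have [i2 e2] := @Rintegral_sum _ _ _ P k (fun i om => t k (xis i om) ^+ 2)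
  (fun i => it2 k (xis i)).
pose s2 om := (\sum_(i < k) (t k (xis i om) - m k)) ^+ 2.
pose t2 om := \sum_(i < k) t k (xis i om) ^+ 2.
pose G om := k%:R ^- 2 * t2 om + (e * k%:R) ^- 2 * s2 om.
have iG : P.-integrable setT (EFin \o G).
  exact: (integrableD measurableT (iZ _ i2) (iZ _ ivar)).
have G0 om : 0 <= G om.
  rewrite addr_ge0// mulr_ge0 ?invr_ge0 ?sqr_ge0//.
  by apply: sumr_ge0 => i _; exact: sqr_ge0.
have sub : dev k e `<=` [set om | 1 <= G om].
  move=> om /= dom.
  have [[i hi]|hn] := pselect (exists i : 'I_k, k%:R <= h (xis i om)).
    rewrite /G -[leLHS]addr0; apply: lerD; last first.
      by rewrite mulr_ge0 ?invr_ge0 ?sqr_ge0.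
    rewrite mulrC ler_pdivlMr ?exprn_gt0// mul1r /t2 (bigD1 i)//=.
    by rewrite /t min_r// lerDl; apply: sumr_ge0 => j _; exact: sqr_ge0.
  have tE i : (i < k)%N -> t k (xis i om) = h (xis i om).
    move=> ik; rewrite /t min_l// leNgt; apply/negP => hi; apply: hn.
    by exists (Ordinal ik); exact: ltW.
  have sE : \sum_(i < k) (t k (xis i om) - m k) = S k om - k%:R * m k.
    by rewrite sumrB sumr_const card_ord mulr_natl; congr (_ - _);
      apply: eq_bigr => i _; rewrite tE.
  rewrite /G -[leLHS]add0r; apply: lerD.
    by rewrite mulr_ge0 ?invr_ge0 ?sqr_ge0//; apply: sumr_ge0 => i _; exact: sqr_ge0.
  rewrite mulrC ler_pdivlMr ?exprn_gt0 ?mulr_gt0// mul1r /s2 sE.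
  have le1 : e * k%:R <= `|S k om - k%:R * m k|.
    apply: (@le_trans _ _ (`|S k om / k%:R - m k| * k%:R)); first by rewrite ler_pM2r.
    by rewrite -[X in _ * X]gtr0_norm// -normrM mulrBl divfK ?gt_eqF// [m k * _]mulrC.
  rewrite -[leRHS]real_normK ?num_real//; apply: lerXn2r le1; rewrite nnegrE//.
  by rewrite mulr_ge0 ?ltW.
apply: (@le_trans _ _ (P [set om | 1 <= G om]%R)).
  apply: le_measure => //; rewrite inE//.
  have := measurable_int P iG => mG.
  have := mG measurableT `[1%E, +oo[%classic (emeasurable_itv _).
  rewrite setTI; congr measurable; apply/seteqP; split => om /=;
    by rewrite in_itv/= andbT lee_fin.
apply: (le_trans (markov_Rintegral ltr01 iG G0)).
rewrite invr1 mul1r lee_fin /G.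
rewrite (RintegralD measurableT (iZ _ i2) (iZ _ ivar)).
rewrite (RintegralZl _ measurableT i2) (RintegralZl _ measurableT ivar) e2.
have qE (i : nat) : \int[P]_om (t k (xis i om) ^+ 2) = q k.
  apply: (iid_Rintegral idist (g := fun x => t k x ^+ 2)).
    exact: measurable_funX.
  by move=> x; exact: sqr_ge0.
rewrite (eq_bigr (fun=> q k)) => [|i _]; last exact: qE.
rewrite sumr_const card_ord -[q k *+ k]mulr_natl.
apply: (@le_trans _ _ (k%:R ^- 2 * (k%:R * q k) + (e * k%:R) ^- 2 * (k%:R * q k))).
  by rewrite lerD2l; apply: ler_wpM2l => //; rewrite invr_ge0 sqr_ge0.
by rewrite le_eqVlt; apply/orP; left; apply/eqP; field; rewrite !gt_eqF.
Qed.

(** The bounds of [weak_law] are summed under the integral, where [geo_trunc_sum] dominates them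
    pointwise by a multiple of [h]. *)
Let dev_summable p (e : R) : 0 < e ->
  (\sum_(n <oo) P (dev (geo p n) e) < +oo)%E.
Proof.
move=> e0.
have g0 n : (0 < geo p n)%N by exact: leq_ltn_trans (geo_gt p n).
pose C := (1 + e ^- 2) * (4 * p.+2%:R * \int[P]_om h (xi om)).
apply: (@le_lt_trans _ _ C%:E); last exact: ltry.
apply: lime_le; first by apply: is_cvg_nneseries => n _ _; exact: measure_ge0.
apply: nearW => M; rewrite big_mkord.
apply: (@le_trans _ _ (\sum_(n < M) ((1 + e ^- 2) *
    (q (geo p n) / (geo p n)%:R))%:E)%E).
  by apply: lee_sum => n _; exact: weak_law.
rewrite sumEFin lee_fin -mulr_sumr; apply: ler_wpM2l.
  by rewrite addr_ge0// invr_ge0 sqr_ge0.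
have i2 n : P.-integrable setT
    (EFin \o (fun om => (geo p n)%:R^-1 * t (geo p n) (xi om) ^+ 2)) by exact: iZ.
have [iM eM] := @Rintegral_sum _ _ _ P M _ i2.
have -> : \sum_(n < M) q (geo p n) / (geo p n)%:R =
    \int[P]_om \sum_(n < M) (geo p n)%:R^-1 * t (geo p n) (xi om) ^+ 2.
  by rewrite eM; apply: eq_bigr => n _; rewrite RintegralZl// mulrC.
rewrite -RintegralZl//; apply: le_Rintegral => //; first exact: iZ.
move=> om _; apply: le_trans (geo_trunc_sum p M (h0 (xi om))).
by rewrite le_eqVlt; apply/orP; left; apply/eqP/eq_bigr => n _; rewrite mulrC.
Qed.

Let m_cvg : m @ \oo --> \int[P]_om h (xi om).
Proof.
have [] := @dominated_convergence _ _ _ P _ measurableT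
  (fun k om => (t k (xi om))%:E) (fun om => (h (xi om))%:E) (fun om => (h (xi om))%:E).
- by move=> k; apply/measurable_EFinP; exact: measurableT_comp.
- by apply/measurable_EFinP; exact: measurableT_comp.
- apply: aeW => om _; apply: cvg_near_cst.
  near=> k; congr EFin; apply: min_l; near: k.
  exists (Num.truncn (h (xi om))).+1 => // k /= hk.
  by rewrite (le_trans (ltW (truncnS_gt _)))// ler_nat.
- exact: ih.
- apply: aeW => om k _; rewrite lee_fin ger0_norm//.
  by rewrite ge_min lexx.
have E : (\int[P]_om (h (xi om))%:E)%E = (\int[P]_om h (xi om))%:E.
  by rewrite /Rintegral fineK// integrable_fin_num.
by move=> _ _; rewrite E => /fine_cvgP[_]; exact.
Unshelve. all: by end_near. Qed.

(** Borel-Cantelli for each of the countably many thresholds [j.+1%:R^-1] brings the averages to the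
    truncated means, which converge by [m_cvg]. *)
Let slln_geo p :
  {ae P, forall om, S (geo p n) om / (geo p n)%:R @[n --> \oo] -->
    \int[P]_om h (xi om)}.
Proof.
have : {ae P, forall om, forall j : nat,
    ~ lim_sup_set (fun n => dev (geo p n) j.+1%:R^-1) om}.
  apply: ae_foralln => j.
  exists (lim_sup_set (fun n => dev (geo p n) j.+1%:R^-1)); split.
  - by apply: bigcap_measurable => // k _; apply: bigcup_measurable.
  - by apply: lim_sup_set_cvg0 => //; apply: dev_summable; rewrite invr_gt0.
  - by move=> om /= /contrapT.
apply: filterS => om hom.
have geooo : geo p @ \oo --> \oo.
  by apply/cvgnyPge => N; exists N => // n /= Nn; rewrite (leq_trans Nn)// ltnW// geo_ge.
have dev0 : (fun n => S (geo p n) om / (geo p n)%:R - m (geo p n)) @ \oo --> (0 : R).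
  apply/cvgr0Pnorm_lt => e e0.
  have [j _ /(_ j (leqnn j)) /= hj] : \forall j \near \oo, j.+1%:R^-1 < e :> R.
    by have /cvgr_lt := @cvg_harmonic R; exact.
  have [n0 hn0] : exists n0, forall n, (n0 <= n)%N -> ~ dev (geo p n) j.+1%:R^-1 om.
    apply: contrapT => /forallNP hn; apply: (hom j) => n0 _.
    have /existsNP[n /not_implyP[n0n /contrapT dn]] := hn n0.
    by exists n.
  exists n0 => // n /= /hn0 /negP; rewrite -ltNge => h'.
  exact: lt_trans hj.
rewrite -[X in _ --> X]add0r; apply: cvg_trans (cvgD dev0 (cvg_comp _ _ geooo m_cvg)).
apply: near_eq_cvg; apply: nearW => n /=.
by rewrite -[RHS](subrK (m (geo p n))).
Qed.

(** Nonnegative summands make the partial sums nondecreasing, as interpolation from all the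
    sequences [geo p] requires. *)
Lemma slln_nonneg : {ae P, forall om,
  (\sum_(i < N) h (xis i om)) / N%:R @[N --> \oo] --> \int[P]_om h (xi om)}.
Proof.
apply: filterS (ae_foralln slln_geo) => om hom.
apply: (@geo_interpolation R (S ^~ om)) => //.
  by move=> n; apply: sumr_ge0.
move=> n k nk; rewrite /S -!(big_mkord predT (fun i => h (xis i om))).
by rewrite (big_cat_nat _ nk)//= lerDl sumr_ge0.
Qed.

End slln_nonneg.

Lemma slln d d' (Om : measurableType d) (X : measurableType d') (R : realType)
    (P : probability Om R) (xi : {mfun Om >-> X}) (xis : nat -> {mfun Om >-> X})
    (h : X -> R) :
  mutually_independent P xis -> (forall i, same_distribution P (xis i) xi) ->
  measurable_fun setT h ->
  P.-integrable setT (EFin \o (fun om => h (xi om))) ->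
  {ae P, forall om, (\sum_(i < N) h (xis i om)) / N%:R @[N --> \oo] -->
    \int[P]_om h (xi om)}.
Proof.
move=> indep idist mh ih.
have ipos := integrable_funrpos measurableT ih.
have ineg := integrable_funrneg measurableT ih.
have mpos : measurable_fun setT h^\+ by exact: measurable_funrpos.
have mneg : measurable_fun setT h^\- by exact: measurable_funrneg.
have l1 := slln_nonneg indep idist mpos (funrpos_ge0 h) ipos.
have l2 := slln_nonneg indep idist mneg (funrneg_ge0 h) ineg.
apply: filterS2 l1 l2 => om h1 h2.
have E x : h^\+ x - h^\- x = h x by rewrite -[in RHS](funrposBneg h).
have -> : (fun om => h (xi om)) = (fun om => h^\+ (xi om) - h^\- (xi om)).
  by apply/funext => om'; rewrite E.
rewrite (RintegralB measurableT ipos ineg); apply: cvg_trans (cvgB h1 h2).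
apply: near_eq_cvg; apply: nearW => N /=.
have -> : \sum_(i < N) h (xis i om) =
    \sum_(i < N) h^\+ (xis i om) - \sum_(i < N) h^\- (xis i om).
  by rewrite -sumrB; apply: eq_bigr => i _; rewrite E.
by rewrite mulrBl.
Qed.

(** * Weak convergence in Hilbert spaces *)

Section hilbert.
Context {R : realType} {U : completeNormedModType R}.
Variable inner : U -> U -> R.
Hypothesis hU : hilbert_inner inner.

Lemma innerC u v : inner u v = inner v u.
Proof. by case: hU. Qed.

Lemma innerP a u v w : inner (a *: u + v) w = a * inner u w + inner v w.
Proof. by case: hU. Qed.

Lemma inner_norm u : inner u u = `|u| ^+ 2.
Proof. by case: hU. Qed.

Lemma innerDl u v w : inner (u + v) w = inner u w + inner v w.
Proof. by rewrite -[u]scale1r innerP mul1r scale1r. Qed.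

Lemma inner0l w : inner 0 w = 0.
Proof. by apply: (addrI (inner 0 w)); rewrite -innerDl !addr0. Qed.

Lemma innerZl a u w : inner (a *: u) w = a * inner u w.
Proof. by rewrite -[_ *: u]addr0 innerP inner0l addr0. Qed.

Lemma innerBl u v w : inner (u - v) w = inner u w - inner v w.
Proof. by rewrite -scaleN1r innerDl innerZl mulN1r. Qed.

Lemma innerDr u v w : inner u (v + w) = inner u v + inner u w.
Proof. by rewrite innerC innerDl ![inner _ u]innerC. Qed.

Lemma innerZr a u w : inner u (a *: w) = a * inner u w.
Proof. by rewrite innerC innerZl innerC. Qed.

Lemma innerBr u v w : inner u (v - w) = inner u v - inner u w.
Proof. by rewrite innerC innerBl ![inner _ u]innerC. Qed.

(** Cauchy-Schwarz, from expanding the squared norm of the combination of [u] and [v] weighted by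
    each other's norms. *)
Lemma inner_le u v : inner u v <= `|u| * `|v|.
Proof.
have [u0|u0] := eqVneq `|u| 0.
  by move/normr0_eq0: u0 => ->; rewrite inner0l normr0 mul0r.
have [v0|v0] := eqVneq `|v| 0.
  by move/normr0_eq0: v0 => ->; rewrite innerC inner0l normr0 mulr0.
have a0 : 0 < `|u| by rewrite lt_def u0 normr_ge0.
have b0 : 0 < `|v| by rewrite lt_def v0 normr_ge0.
have := sqr_ge0 `| `|v| *: u - `|u| *: v |.
rewrite -inner_norm innerBl !innerBr !innerZl !innerZr !inner_norm (innerC v u).
rewrite -subr_ge0 => h.
have : 0 <= (2 * `|u| * `|v|) * (`|u| * `|v| - inner u v).
  by apply: le_trans h _; rewrite le_eqVlt; apply/orP; left; apply/eqP; ring.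
by rewrite pmulr_rge0 ?subr_ge0// !mulr_gt0.
Qed.

Lemma inner_norm_le u v : `|inner u v| <= `|u| * `|v|.
Proof.
rewrite ler_norml inner_le andbT lerNl -mulN1r -innerZl scaleN1r.
by rewrite (le_trans (inner_le _ _))// normrN.
Qed.

Definition convex_subset (C : set U) := forall (t : R) u v, 0 <= t <= 1 ->
  C u -> C v -> C (t *: u + (1 - t) *: v).

Section quadratic_minimization.
Variables (L : U -> R) (M : R).
Hypothesis Llin : forall a u v, L (a *: u + v) = a * L u + L v.
Hypothesis Lbd : forall v, `|L v| <= M * `|v|.

Let LD u v : L (u + v) = L u + L v.
Proof. by rewrite -[u]scale1r Llin mul1r scale1r. Qed.
Let L0 : L 0 = 0.
Proof. by apply: (addrI (L 0)); rewrite -LD !addr0. Qed.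
Let LZ a u : L (a *: u) = a * L u.
Proof. by rewrite -[_ *: u]addr0 Llin L0 addr0. Qed.
Let LB u v : L (u - v) = L u - L v.
Proof. by rewrite -scaleN1r LD LZ mulN1r. Qed.

(** For [L = inner x] this is the squared distance to [x] up to a constant. *)
Let J v : R := `|v| ^+ 2 - 2 * L v.

(** The linear parts cancel in the parallelogram identity; this makes minimizing sequences of [J]
    Cauchy. *)
Let J_parallelogram u v :
  `|u - v| ^+ 2 = 2 * J u + 2 * J v - 4 * J (2^-1 *: u + (1 - 2^-1) *: v).
Proof.
rewrite /J LD !LZ -!inner_norm innerBl !innerBr innerDl !innerDr !innerZl !innerZr.
rewrite (innerC v u); have -> : 1 - 2^-1 = 2^-1 :> R by lra.
by field.
Qed.

Let J_ge v : - M ^+ 2 <= J v.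
Proof.
have := Lbd v; rewrite ler_norml => /andP[_ h].
rewrite /J; have := sqr_ge0 (`|v| - M) => h2.
by nra.
Qed.

Let J_cvg (v : nat -> U) p : v @ \oo --> p -> (J \o v) @ \oo --> J p.
Proof.
move=> vp; apply: cvgB.
  by rewrite expr2; under eq_fun do rewrite expr2; apply: cvgM; exact: cvg_norm.
apply: cvgMr; apply/cvgrPdist_le => e e0.
have M1 : 0 < `|M| + 1 by rewrite ltr_pwDr.
move/cvgrPdist_le : vp => /(_ (e / (`|M| + 1)) (divr_gt0 e0 M1)).
apply: filterS => n hn; rewrite -LB (le_trans (Lbd _))//.
apply: (@le_trans _ _ ((`|M| + 1) * `|p - v n|)).
  by apply: ler_wpM2r => //; rewrite (le_trans (ler_norm _))// lerDl.
by rewrite mulrC -ler_pdivlMr.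
Qed.

(* [C = setT] yields the Riesz representation, [L = inner x] the projection of
   [x] on [C]. *)
Lemma variational_inequality (C : set U) : C !=set0 -> closed C -> convex_subset C ->
  exists2 p, C p & forall v, C v -> L (v - p) <= inner p (v - p).
Proof.
move=> [c0 Cc0] clC cvC.
pose S := [set J v | v in C].
have hS : has_inf S.
  split; first by exists (J c0), c0.
  by exists (- M ^+ 2) => _ [v _ <-].
have infS v : C v -> inf S <= J v.
  by move=> Cv; apply: ge_inf; [case: hS|exists v].
have /choice[v Pv] : forall n : nat, exists v, C v /\ J v < inf S + n.+1%:R^-1.
  move=> n; have [|_ [v Cv <-] h] := @inf_adherent _ S n.+1%:R^-1 _ hS.
    by rewrite invr_gt0.
  by exists v.
have Cv n : C (v n) by case: (Pv n).
have Jv n : J (v n) < inf S + n.+1%:R^-1 by case: (Pv n).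
(* By convexity the midpoint lies in [C], so [J] there is at least the infimum. *)
have dist n m : `|v n - v m| ^+ 2 <= 2 * n.+1%:R^-1 + 2 * m.+1%:R^-1.
  rewrite J_parallelogram.
  have h01 : (0 <= (2^-1 : R)) && ((2^-1 : R) <= 1) by apply/andP; split; lra.
  have := infS _ (cvC _ _ _ h01 (Cv n) (Cv m)).
  have := Jv n; have := Jv m.
  move: (J _) (J _) (J _) (inf S) (n.+1%:R^-1) (m.+1%:R^-1).
  by move=> a b c i x y h1 h2 h3; lra.
have /cauchy_cvgP : cauchy (v @ \oo).
  apply/cauchyP => e e0 /=.
  have e40 : 0 < e ^+ 2 / 8 by rewrite divr_gt0// exprn_gt0.
  have [N _ HN] : \forall n \near \oo, n.+1%:R^-1 < e ^+ 2 / 8 :> R.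
    by have /cvgr_lt := @cvg_harmonic R; exact.
  exists (v N); exists N => // n Nn /=.
  rewrite -ball_normE /ball_/=.
  have := dist N n => h.
  have h1 : N.+1%:R^-1 < e ^+ 2 / 8 := HN N (leqnn N).
  have h2 : n.+1%:R^-1 < e ^+ 2 / 8 := HN n Nn.
  rewrite -(@ltr_pXn2r _ 2)//.
  - apply: le_lt_trans h _; move: h1 h2 (exprn_gt0 2 e0).
    by move: (N.+1%:R^-1) (n.+1%:R^-1) (e ^+ 2) => a b c *; lra.
  - by rewrite nnegrE.
  - by rewrite nnegrE ltW.
move=> /cvg_ex[p vp].
have Cp : C p by apply: (closed_cvg C) vp => //; exact: nearW.
have Jp : J p <= inf S.
  have h1 : (fun n => inf S + n.+1%:R^-1) @ \oo --> inf S + 0.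
    by apply: cvgD; [exact: cvg_cst|exact: cvg_harmonic].
  rewrite -[inf S]addr0; apply: (ler_cvg_to (J_cvg vp) h1).
  by apply: nearW => n; exact/ltW/Jv.
exists p => // w Cw; rewrite leNgt; apply/negP => hlt.
set s := inner p (w - p) - L (w - p); set q := `|w - p| ^+ 2.
have s0 : s < 0 by rewrite subr_lt0.
have q0 : 0 <= q by exact: sqr_ge0.
have qs : 0 < q - s by lra.
(* Moving from [p] by [t] towards [w] changes [J] by [t * (t * q + 2 * s)]. This [t] makes the
   second factor [s + t * s < 0], and the denominator [q - s] keeps [t] in [(0, 1]] without
   discussing [q = 0]. *)
pose t := - s / (q - s).
have t01 : 0 < t <= 1.
  by rewrite /t divr_gt0 ?oppr_gt0//= ler_pdivrMr//; lra.
have t01' : 0 <= t <= 1 by case/andP: t01 => /ltW -> ->.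
have := infS _ (cvC _ _ _ t01' Cw Cp); move=> /(le_trans Jp).
have -> : t *: w + (1 - t) *: p = p + t *: (w - p).
  by rewrite scalerBl scale1r scalerBr addrCA.
rewrite /J LD LZ -!inner_norm innerDl !innerDr !innerZl !innerZr.
rewrite (innerC (w - p) p) (inner_norm (w - p)) -/q => h.
have : 0 <= t * (t * q + 2 * s) by rewrite /s; lra.
rewrite pmulr_rge0; last by case/andP: t01.
have tE : t * (q - s) = - s by rewrite /t divfK// gt_eqF.
have ts : t * s <= 0 by rewrite mulr_ge0_le0// ?ltW//; case/andP: t01.
nra.
Qed.

End quadratic_minimization.

(** On the whole space the variational inequality may be tested at [p + w] and at [p - w], which
    yields both inequalities. *)
Lemma riesz_representation (L : U -> R) (M : R) :
  (forall a u v, L (a *: u + v) = a * L u + L v) ->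
  (forall v, `|L v| <= M * `|v|) ->
  exists x, forall w, L w = inner x w.
Proof.
move=> Llin Lbd.
have [p _ hp] := variational_inequality Llin Lbd (ex_intro setT 0 I)
  (@closedT _) (fun _ _ _ _ _ _ => I).
have L0 : L 0 = 0.
  by apply: (addrI (L 0)); have := Llin 1 0 0; rewrite scale1r mul1r !addr0.
exists p => w; apply/eqP; rewrite eq_le; apply/andP; split.
  by have := hp (p + w) I; rewrite addrC addKr.
have := hp (p - w) I; rewrite addrAC subrr add0r -scaleN1r.
by rewrite -[_ *: w]addr0 Llin L0 !addr0 innerZr !mulN1r lerN2.
Qed.

(** If [p] is the projection of [x] on [C], then [C] lies in the half-space
    [inner (v - p) (x - p) <= 0]. This inequality passes to the weak limit, where it forces
    [x = p]. *)
Lemma convex_weakly_closed (C : set U) T (F : set_system T) (u : T -> U) x :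
  ProperFilter F -> closed C -> convex_subset C -> F (u @^-1` C) ->
  (forall w, (fun n => inner (u n) w) @ F --> inner x w) -> C x.
Proof.
move=> FF clC cvC Cu ux.
have [n0 Cn0] := filter_ex Cu.
have bd v : `|inner v x| <= `|x| * `|v| by rewrite mulrC inner_norm_le.
have [p Cp hp] := variational_inequality (fun a v w => innerP a v w x) bd
  (ex_intro C (u n0) Cn0) clC cvC.
suff /eqP : `|x - p| ^+ 2 = 0 by rewrite sqrf_eq0 normr_eq0 subr_eq0 => /eqP ->.
apply/eqP; rewrite eq_le sqr_ge0 andbT -inner_norm.
have h : (fun n => inner (u n) (x - p) - inner p (x - p)) @ F -->
    inner x (x - p) - inner p (x - p) by apply: cvgB => //; exact: cvg_cst.
rewrite innerBl; apply: (closed_cvg [set r : R | r <= 0]) h; first exact: closed_le.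
apply: filterS Cu => n /hp h.
by rewrite /mkset -innerBl innerBr subr_le0 (innerC _ p).
Qed.

End hilbert.

(** A cluster point of an ultrafilter is a limit: were the preimage of a neighbourhood not in [F],
    its complement would be. *)
Lemma ultra_compact_cvg T (F : set_system T) (X : topologicalType) (A : set X)
    (f : T -> X) :
  UltraFilter F -> compact A -> F (f @^-1` A) -> exists2 p, A p & f @ F --> p.
Proof.
move=> FU cA FA; have [p [Ap clp]] := cA (f @ F) _ FA.
exists p => // V Vp; have [//|FV] := in_ultra_setVsetC (f @^-1` V) FU.
by have [y []] := clp (~` V) V FV Vp.
Qed.

(** * Dense sequences, weak compactness and extraction of subsequences *)

Section separable.
Context {R : realType} {W : normedModType R}.

Lemma dense_sequence : separable_space W ->
  exists e : nat -> W, forall w (r : R), 0 < r -> exists j, `|w - e j| < r.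
Proof.
move=> [D [cD dD]].
have /pfcard_geP[D0|[e]] := cD.
  have [d0 []] : [set: W] `&` D !=set0.
    by apply: dD; [exists 0|exact: openT].
  by rewrite D0.
exists e => w r r0.
have [d [wd Dd]] : ball w r `&` D !=set0.
  by apply: dD; [exists w; exact: ballxx|exact: ball_open].
have [j _ jd] := 'surj_e Dd; exists j.
by move: wd; rewrite -jd -ball_normE.
Qed.

(** For each dense point [e j] and scale [k.+1%:R^-1], a point of [S] that close to [e j] is chosen
    if there is one, and [s0] otherwise. *)
Lemma dense_sequence_in (S : set W) : separable_space W -> S !=set0 ->
  exists c : nat -> W, (forall i, S (c i)) /\
    forall w (r : R), S w -> 0 < r -> exists i, `|w - c i| < r.
Proof.
move=> /dense_sequence[e eP] [s0 Ss0].
have /choice[g gP] : forall jk : nat * nat, exists s, S s /\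
    ((exists2 s', S s' & `|e jk.1 - s'| < jk.2.+1%:R^-1) ->
      `|e jk.1 - s| < jk.2.+1%:R^-1).
  move=> [j k] /=; have [[s Ss h]|h] :=
    pselect (exists2 s', S s' & `|e j - s'| < k.+1%:R^-1); first by exists s.
  by exists s0.
(* The pairs are enumerated by [unpickle]; numbers that code no pair get a default. *)
exists (fun n => g (odflt (0%N, 0%N) (unpickle n))); split => [i|w r Sw r0].
  by case: (gP (odflt (0%N, 0%N) (unpickle i))).
have [k _ /(_ k (leqnn k)) /= hk] : \forall n \near \oo, n.+1%:R^-1 < r / 2 :> R.
  by have /cvgr_lt := @cvg_harmonic R; apply; rewrite divr_gt0.
have k0 : 0 < k.+1%:R^-1 :> R by rewrite invr_gt0.
have [j hj] := eP w _ k0.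
exists (pickle (j, k)); rewrite pickleK /=.
have [_ /= h] := gP (j, k).
have hw : `|e j - g (j, k)| < k.+1%:R^-1 by apply: h; exists w => //; rewrite distrC.
rewrite -(subrK (e j) w) -addrA (le_lt_trans (ler_normD _ _))//.
by rewrite [r]splitr ltrD// (lt_trans _ hk).
Qed.

End separable.

Section weak.
Context {R : realType} {U : completeNormedModType R}.
Variable inner : U -> U -> R.
Hypothesis hU : hilbert_inner inner.

(** Each [inner (u n) w] stays in a compact interval, hence converges along the ultrafilter; the
    limit is linear and bounded in [w], so Riesz represents it by some [x]. *)
Lemma weak_compactness T (F : set_system T) (u : T -> U) (M : R) :
  UltraFilter F -> F [set n | `|u n| <= M] ->
  exists x, forall w, (fun n => inner (u n) w) @ F --> inner x w.
Proof.
move=> FU FM.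
have FF : ProperFilter F by exact: ultra_proper.
have /choice[L LP] : forall w, exists l : R,
    `|l| <= M * `|w| /\ (fun n => inner (u n) w) @ F --> l.
  move=> w; have [||l] := @ultra_compact_cvg _ F _
      `[- (M * `|w|), M * `|w|]%classic (fun n => inner (u n) w) FU.
  - exact: segment_compact.
  - apply: filterS FM => n /= un; rewrite in_itv/= -ler_norml.
    by rewrite (le_trans (inner_norm_le hU _ _))// ler_wpM2r.
  by rewrite /= in_itv/= -ler_norml => lM cl; exists l.
have Llin a v w : L (a *: v + w) = a * L v + L w.
  have h : (fun n => inner (u n) (a *: v + w)) @ F --> a * L v + L w.
    under eq_fun do rewrite (innerDr hU) (innerZr hU).
    by apply: cvgD; [apply: cvgMr|]; case: (LP v); case: (LP w).
  by have [_ h'] := LP (a *: v + w); exact: (cvg_unique _ h' h).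
have [x xP] := riesz_representation hU Llin (fun w => (LP w).1).
by exists x => w; rewrite -xP; case: (LP w).
Qed.

(** Each new index is chosen beyond the previous one so as to match [x] against the first [n] dense
    directions within [n.+1%:R^-1]; boundedness then extends convergence to every direction. *)
Lemma weak_acc_point_of_filter (F : set_system nat) (u : nat -> U) (M : R) x :
  separable_space U -> ProperFilter F -> \oo `<=` F ->
  F [set n | `|u n| <= M] ->
  (forall w, (fun n => inner (u n) w) @ F --> inner x w) ->
  weak_acc_point inner u x.
Proof.
move=> /dense_sequence[e eP] FF ooF FM ux.
have Fe n (r : R) : 0 < r ->
    F [set k | forall j, (j < n)%N -> `|inner (u k) (e j) - inner x (e j)| < r].
  move=> r0; elim: n => [|n IH]; first by apply: filterS filterT.
  have h : F [set k | `|inner (u k) (e n) - inner x (e n)| < r].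
    have /cvgrPdist_lt/(_ r r0) := ux (e n).
    by apply: filterS => k /=; rewrite distrC.
  apply: filterS (filterI IH h) => k [h1 h2] j.
  by rewrite ltnS leq_eqVlt => /predU1P[->//|]; exact: h1.
have /choice[g gP] : forall nm : nat * nat, exists k, [/\ (nm.2 < k)%N,
    `|u k| <= M & forall j, (j < nm.1)%N ->
    `|inner (u k) (e j) - inner x (e j)| < nm.1.+1%:R^-1].
  move=> [n m] /=; have n0 : 0 < n.+1%:R^-1 :> R by rewrite invr_gt0.
  have hm : F [set k | (m < k)%N] by apply: ooF; exists m.+1.
  by have [k [[h1 h2] h3]] := filter_ex (filterI (filterI hm FM) (Fe n _ n0));
    exists k.
pose phi := fix phi n := if n is n'.+1 then g (n, phi n') else g (0%N, 0%N).
have phiM n : `|u (phi n)| <= M.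
  by case: n => [|n]; [case: (gP (0%N, 0%N))|case: (gP (n.+1, phi n))].
have phij n j : (j < n)%N ->
    `|inner (u (phi n)) (e j) - inner x (e j)| < n.+1%:R^-1.
  by case: n => [//|n] jn; case: (gP (n.+1, phi n)) => _ _; exact.
exists phi; split; first by move=> k; case: (gP (k.+1, phi k)).
move=> w; apply/cvgrPdist_lt => r r0.
have M0 : 0 <= M by exact: le_trans (phiM 0%N).
have K0 : 0 < M + `|x| + 1 by rewrite ltr_wpDl// addr_ge0.
have r20 : 0 < r / 2 by rewrite divr_gt0.
(* Replacing [w] by this [e j] costs less than [r / 2], uniformly along the subsequence. *)
have [j hj] := eP w _ (divr_gt0 r20 K0).
have near1 : \forall n \near \oo, n.+1%:R^-1 < r / 2 :> R.
  by have /cvgr_lt := @cvg_harmonic R; exact.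
near=> n.
have jn : (j < n)%N by near: n; exists j.+1.
have hn : n.+1%:R^-1 < r / 2 :> R by near: n.
rewrite /= distrC -innerBl// -(subrK (e j) w) innerDr// [r]splitr.
rewrite (le_lt_trans (ler_normD _ _))// ltr_leD//; last first.
  by rewrite innerBl// ltW// (lt_trans (phij _ _ jn)).
rewrite (le_lt_trans (inner_norm_le hU _ _))//.
apply: (@le_lt_trans _ _ ((M + `|x| + 1) * `|w - e j|)).
  apply: ler_wpM2r => //; rewrite (le_trans (ler_normB _ _))//.
  by rewrite -addrA lerD// lerDl.
by rewrite mulrC -ltr_pdivlMr.
Unshelve. all: by end_near. Qed.

End weak.

(** * Epi-convergence and minimizers *)

Section epi_convergence.
Context {R : realType} {U : completeNormedModType R} {W : completeNormedModType R}.
Variables (inner : U -> U -> R) (hU : hilbert_inner inner).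
Hypothesis sepU : separable_space U.
Variables (B : {linear U -> W}) (cB : compact_operator B).
Variable psi : U -> \bar R.
Hypotheses (psi_ge0 : forall u, (0 <= psi u)%E)
  (psi_closed : lower_semicontinuous psi) (psi_convex : convex_efun psi)
  (psi_bdd : bounded_set (edom psi)).

(** The image of the unit ball has compact, hence bounded, closure. *)
Lemma compact_operator_continuous : continuous B.
Proof.
apply: bounded_linear_continuous.
have b1 : bounded_set (ball (0 : U) 1).
  exists 1; split => // M M1 u; rewrite -ball_normE /= sub0r normrN => /ltW u1.
  exact/ltW/(le_lt_trans u1).
have [M [Mr hM]] := compact_bounded (cB b1).
apply/ex_bound; exists (M + 1).
apply/nbhs_ballP; exists 1 => //= u u1; apply: (hM (M + 1)); first by rewrite ltrDl.
by apply: subset_closure; exists u.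
Qed.

Lemma sublevel_closed (a : R) : closed [set u | (psi u <= a%:E)%E].
Proof.
have := lower_semicontinuousP psi; move=> [/(_ psi_closed)/(_ a) o _].
rewrite -openC; congr open: o; apply/seteqP; split => u /=.
  by move=> h; apply/negP; rewrite -ltNge.
by move/negP; rewrite -ltNge.
Qed.

Lemma sublevel_convex (a : R) : convex_subset [set u | (psi u <= a%:E)%E].
Proof.
move=> t u v /= /[dup] t01 /andP[t0 t1] ua va.
apply: (le_trans (psi_convex u v t01)).
have -> : a%:E = (t%:E * a%:E + (1 - t)%:E * a%:E)%E.
  by rewrite -!EFinM -EFinD -mulrDl addrC subrK mul1r.
by apply: leeD; apply: lee_wpmul2l; rewrite ?lee_fin ?subr_ge0.
Qed.

(** Sublevel sets of [psi] are closed and convex, hence weakly closed. *)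
Lemma weak_lower_semicontinuity T (F : set_system T) (u : T -> U) x (a : R) :
  ProperFilter F -> F [set n | (psi (u n) <= a%:E)%E] ->
  (forall w, (fun n => inner (u n) w) @ F --> inner x w) -> (psi x <= a%:E)%E.
Proof.
move=> FF Fa ux.
have := convex_weakly_closed hU FF (@sublevel_closed a) (@sublevel_convex a).
by move=> /(_ _ _ Fa ux).
Qed.

(* A strong cluster point [y] of [B u] must be [B x]: the preimage of every
   closed ball around [y] is closed and convex, hence weakly closed. *)
Lemma compact_operator_weak_cvg T (F : set_system T) (u : T -> U) x :
  UltraFilter F -> F [set n | edom psi (u n)] ->
  (forall w, (fun n => inner (u n) w) @ F --> inner x w) ->
  (fun n => B (u n)) @ F --> B x.
Proof.
move=> FU Fe ux.
have FF : ProperFilter F by exact: ultra_proper.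
have [|y _ By] := @ultra_compact_cvg _ F _ _ (fun n => B (u n)) FU (cB psi_bdd).
  by apply: filterS Fe => n en; apply: subset_closure; exists (u n).
suff -> : B x = y by [].
apply/eqP; rewrite eq_sym -subr_eq0 -normr_le0; apply/ler_addgt0Pr => e e0.
rewrite add0r.
pose C := [set v : U | `|y - B v| <= e].
have clC : closed C.
  have cf : continuous (fun v : U => `|y - B v|).
    move=> v; apply: cvg_norm; apply: cvgB; first exact: cvg_cst.
    exact: compact_operator_continuous.
  apply: (@closed_comp _ _ (fun v : U => `|y - B v|) [set r : R | r <= e]).
    by move=> v _; exact: cf.
  exact: closed_le.
have cvC : convex_subset C.
  move=> t v w /andP[t0 t1] hv hw; rewrite /C /= linearD !linearZ/=.
  have -> : y - (t *: B v + (1 - t) *: B w) = t *: (y - B v) + (1 - t) *: (y - B w).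
    rewrite !scalerBr addrACA -scalerDl [t + _]addrC subrK scale1r.
    by rewrite -opprD.
  rewrite (le_trans (ler_normD _ _))// !normrZ !ger0_norm ?subr_ge0//.
  apply: (@le_trans _ _ (t * e + (1 - t) * e)).
    by rewrite lerD// ler_wpM2l// subr_ge0.
  by rewrite -mulrDl addrC subrK mul1r.
apply: (convex_weakly_closed hU FF clC cvC _ ux).
by have /cvgrPdist_le := By; exact.
Qed.

(** * Consequences of epi-convergence on a fixed sample path *)

Variables (Fh : nat -> W -> R) (F : W -> R) (th : R) (u v : nat -> U).
Hypothesis Fh_bounded : exists K : R, \forall N \near \oo,
  forall w, edom psi w -> `|Fh N (B w)| <= K.
(** The lower half of epi-convergence, uniform on a ball so that it applies at the moving points
    [B (u N)]. The upper half is [Fh_cvg] along the minimizing sequence [v]. *)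
Hypothesis Fh_liminf : forall w (e : R), (B @` edom psi) w -> 0 < e ->
  exists2 r : R, 0 < r & \forall N \near \oo,
    forall w', (B @` edom psi) w' -> `|w - w'| < r -> F w - e <= Fh N w'.
Hypothesis Fh_cvg : forall j, Fh N (B (v j)) @[N --> \oo] --> F (B (v j)).
Hypothesis v_min : forall j,
  ((F (B (v j)))%:E + psi (v j) <= (th + j.+1%:R^-1)%:E)%E.
Hypothesis th_inf : forall x, (th%:E <= (F (B x))%:E + psi x)%E.
Hypothesis solves : forall N, (0 < N)%N -> forall w,
  ((Fh N (B (u N)))%:E + psi (u N) <= (Fh N (B w))%:E + psi w)%E.

Let val N : \bar R := ((Fh N (B (u N)))%:E + psi (u N))%E.

Let psiv j : (psi (v j) < +oo)%E.
Proof.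
rewrite ltey; apply/eqP => e; have := v_min j.
by rewrite e addey// leye_eq.
Qed.

Let psi_fin w : (psi w < +oo)%E -> psi w \is a fin_num.
Proof. by move=> h; rewrite ge0_fin_numE. Qed.

Let psiu N : (0 < N)%N -> (psi (u N) < +oo)%E.
Proof.
move=> N0; rewrite ltey; apply/eqP => e; have := solves N0 (v 0%N).
by rewrite e addey// leye_eq -(fineK (psi_fin (psiv 0))) -EFinD.
Qed.

Let val_fin N : (0 < N)%N -> val N = (Fh N (B (u N)) + fine (psi (u N)))%:E.
Proof. by move=> N0; rewrite EFinD fineK// psi_fin// psiu. Qed.

Let near0 : \forall N \near \oo, (0 < N)%N.
Proof. by exists 1%N. Qed.

(** Comparison with the competitor [v 0]. The bound survives weak limits and so places them in the
    domain of [psi]. *)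
Let psi_u_bounded : exists a : R, \forall N \near \oo, (psi (u N) <= a%:E)%E.
Proof.
have [K hK] := Fh_bounded.
exists (2 * K + fine (psi (v 0%N))).
near=> N; have N0 : (0 < N)%N by near: N.
have hN : forall w, edom psi w -> `|Fh N (B w)| <= K by near: N.
have := solves N0 (v 0%N); rewrite -/(val N) (val_fin N0).
rewrite -(fineK (psi_fin (psiv 0))) -EFinD -(fineK (psi_fin (psiu N0))) !lee_fin.
have := hN _ (psiu N0); have := hN _ (psiv 0%N).
by rewrite !ler_norml => /andP[? ?] /andP[? ?] ?; lra.
Unshelve. all: by end_near. Qed.

Let u_bounded : exists M : R, \forall N \near \oo, `|u N| <= M.
Proof.
have [M [_ hM]] := psi_bdd; exists (M + 1).
near=> N; apply: (hM (M + 1)); first by rewrite ltrDl.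
by apply: psiu; near: N.
Unshelve. all: by end_near. Qed.

Let val_limsup (e : R) : 0 < e -> \forall N \near \oo, (val N <= (th + e)%:E)%E.
Proof.
move=> e0; have e20 : 0 < e / 2 by rewrite divr_gt0.
have [j _ /(_ j (leqnn j)) /= hj] : \forall j \near \oo, j.+1%:R^-1 < e / 2 :> R.
  by have /cvgr_lt := @cvg_harmonic R; exact.
have /cvgrPdist_le/(_ _ e20) hF := @Fh_cvg j.
near=> N; have N0 : (0 < N)%N by near: N.
have := solves N0 (v j); rewrite -/(val N) => /le_trans; apply.
have := v_min j; rewrite -(fineK (psi_fin (psiv j))) -!EFinD !lee_fin => h1.
have : `|F (B (v j)) - Fh N (B (v j))| <= e / 2 by near: N.
rewrite ler_distl => /andP[h2 h3].
by move: hj h1; move: (j.+1%:R^-1) => i hj h1; lra.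
Unshelve. all: by end_near. Qed.

(** Since [B (u N)] converges strongly to [B x], the lower bound [Fh_liminf] leaves
    [psi (u N) <= a - F (B x) + e] along [G], and weak lower semicontinuity carries this over to
    [x]. *)
Let val_liminf (G : set_system nat) x (a : R) : UltraFilter G -> \oo `<=` G ->
  (forall w, (fun n => inner (u n) w) @ G --> inner x w) ->
  G [set N | (val N <= a%:E)%E] -> ((F (B x))%:E + psi x <= a%:E)%E.
Proof.
move=> GU ooG ux Ga.
have GF : ProperFilter G by exact: ultra_proper.
have G0 : G [set N | (0 < N)%N] by exact: ooG.
have Ge : G [set N | edom psi (u N)] by apply: filterS G0 => N; exact: psiu.
have [b hb] := psi_u_bounded.
have psix : (psi x < +oo)%E.
  by apply: le_lt_trans (weak_lower_semicontinuity GF (ooG _ hb) ux) (ltry _).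
rewrite -(fineK (psi_fin psix)) -EFinD lee_fin; apply/ler_addgt0Pr => e e0.
have [|r r0 hr] := @Fh_liminf (B x) e _ e0; first by exists x.
have /cvgrPdist_lt/(_ _ r0) hB := compact_operator_weak_cvg GU Ge ux.
have : (psi x <= (a - F (B x) + e)%:E)%E.
  apply: (weak_lower_semicontinuity GF _ ux).
  apply: filterS (filterI (filterI (filterI Ga G0) (ooG _ hr)) hB).
  move=> N [[[/= h1 h2] h3] h4].
  have := h3 _ (ex_intro2 _ _ (u N) (psiu h2) erefl) h4.
  move: h1; rewrite (val_fin h2) -{2}(fineK (psi_fin (psiu h2))) !lee_fin => *.
  lra.
by rewrite -{1}(fineK (psi_fin psix)) lee_fin => *; lra.
Qed.

Lemma epi_cvg_optimal_value : val N @[N --> \oo] --> th%:E.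
Proof.
apply/fine_cvgP; split.
  by apply: filterS near0 => N N0; rewrite val_fin.
apply/cvgrPdist_le => e e0.
have hlow : \forall N \near \oo, th - e <= fine (val N).
  (* Otherwise [val N <= th - e] for arbitrarily large [N]; a weak limit along an ultrafilter on
     these indices would have objective value below the infimum. *)
  apply: contrapT => hn.
  pose D := [set N | (val N <= (th - e)%:E)%E].
  have GF : ProperFilter (within D \oo).
    split; last exact: within_filter.
    move=> h; have {}h : \forall N \near \oo, ~ D N by exact: h.
    apply: hn; apply: filterS (filterI h near0) => N [hN N0].
    rewrite leNgt; apply/negP => hlt; apply: hN.
    by rewrite /D /= (val_fin N0) lee_fin; move: hlt; rewrite (val_fin N0) => /ltW.
  have [G [GU GG]] := ultraFilterLemma GF.
  have ooG : \oo `<=` G.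
    by move=> A hA; apply: GG; apply: filterS hA => N hA _.
  have [M hM] := u_bounded.
  have [x ux] := weak_compactness hU GU (ooG _ hM).
  have GD : G D by apply: GG; exists 0%N.
  have := le_trans (th_inf x) (val_liminf GU ooG ux GD).
  by rewrite lee_fin => ?; lra.
near=> N; have N0 : (0 < N)%N by near: N.
rewrite ler_distl.
have h1 : th - e <= fine (val N) by near: N.
have : (val N <= (th + e)%:E)%E by near: N; exact: val_limsup.
by rewrite /= (val_fin N0) lee_fin => h2; move: h1; rewrite (val_fin N0) /= => h1;
  apply/andP; split; lra.
Unshelve. all: by end_near. Qed.

Lemma epi_cvg_weak_acc_point : exists x, weak_acc_point inner u x.
Proof.
have [G [GU ooG]] := ultraFilterLemma (_ : ProperFilter \oo).
have [M hM] := u_bounded.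
have [x ux] := weak_compactness hU GU (ooG _ hM).
by exists x; apply: (weak_acc_point_of_filter hU sepU _ ooG (ooG _ hM) ux).
Qed.

(** An ultrafilter refining the image of [\oo] under [phi] has [x] as weak limit, so [val_liminf]
    applies with [a = th + e] for every [e > 0]. *)
Lemma epi_cvg_minimizer x w : weak_acc_point inner u x ->
  ((F (B x))%:E + psi x <= (F (B w))%:E + psi w)%E.
Proof.
move=> [phi [phiS phix]].
have phi_ge n : (n <= phi n)%N.
  by elim: n => [//|n IH]; exact: leq_ltn_trans (phiS n).
have phioo : phi @ \oo --> \oo.
  by apply/cvgnyPge => n; exists n => // k /= nk; exact: leq_trans (phi_ge k).
have [G [GU phiG]] := ultraFilterLemma (_ : ProperFilter (phi @ \oo)).
have ooG : \oo `<=` G by move=> A /phioo /phiG.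
have ux w' : (fun n => inner (u n) w') @ G --> inner x w'.
  by move=> A /phix hA; apply: phiG.
apply: le_trans (th_inf w); apply/lee_addgt0Pr => e e0.
rewrite -EFinD; apply: (val_liminf GU ooG ux).
by apply: ooG; exact: val_limsup.
Qed.

End epi_convergence.

(** * Infima of the integrand over small balls *)

Section local_infimum.
Context {R : realType} {W : normedModType R} {X : Type}.
Variables (S : set W) (f : W -> X -> R) (zeta : X -> R) (c : nat -> W).
Hypothesis fcont : forall x, {within S, continuous (fun w => f w x)}.
Hypothesis fbound : forall w x, S w -> `|f w x| <= zeta x.
Hypothesis cS : forall i, S (c i).
Hypothesis cdense : forall w (r : R), S w -> 0 < r -> exists i, `|w - c i| < r.

Lemma within_dist x w (e : R) : S w -> 0 < e ->
  exists2 r : R, 0 < r & forall w', S w' -> `|w - w'| < r -> `|f w x - f w' x| < e.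
Proof.
move=> Sw e0; have := @fcont x => /subspace_continuousP/(_ w Sw).
move=> /cvgrPdist_lt/(_ e e0); rewrite near_withinE => /nbhs_ballP[r /= r0 hr].
by exists r => // w' Sw' h; apply: hr => //; rewrite -ball_normE.
Qed.

(** Indices outside the ball repeat the value at its centre, so that the sequence runs over all of
    [nat] while its range is the set of values at dense points of the ball. *)
Definition nearby_values j k x i : R :=
  if `|c j - c i| < k.+1%:R^-1 then f (c i) x else f (c j) x.

Definition local_inf j k x : R := infs (nearby_values j k x) 0.

Let near_bound j k x i : `|nearby_values j k x i| <= zeta x.
Proof. by rewrite /nearby_values; case: ifP => _; exact: fbound. Qed.

Let has_lb j k x : has_lbound (sdrop (nearby_values j k x) 0).
Proof.
exists (- zeta x) => _ [i _ <-].
by have := near_bound j k x i; rewrite ler_norml => /andP[].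
Qed.

Let local_inf_le j k x i : `|c j - c i| < k.+1%:R^-1 -> local_inf j k x <= f (c i) x.
Proof.
by move=> h; apply: ge_inf; [exact: has_lb|exists i => //; rewrite /nearby_values h].
Qed.

Lemma le_local_inf j k x (a : R) :
  (forall i, `|c j - c i| < k.+1%:R^-1 -> a <= f (c i) x) -> a <= local_inf j k x.
Proof.
move=> h; apply: lb_le_inf; first by exists (nearby_values j k x 0); exists 0%N.
move=> _ [i _ <-]; rewrite /nearby_values; case: ifP => [/h//|_].
by apply: h; rewrite subrr normr0 invr_gt0.
Qed.

(** Dense points close to [w] stay in the open ball, and continuity on [S] transfers the bound from
    them to [w]. *)
Lemma local_inf_lower_bound j k x w : S w -> `|c j - w| < k.+1%:R^-1 ->
  local_inf j k x <= f w x.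
Proof.
move=> Sw cw; apply/ler_addgt0Pr => e e0.
have [r r0 hr] := within_dist x Sw e0.
have d0 : 0 < Num.min r (k.+1%:R^-1 - `|c j - w|) by rewrite lt_min r0 subr_gt0.
have [i] := cdense Sw d0; rewrite lt_min => /andP[i1 i2].
have := hr _ (cS i) i1; rewrite ltr_distl => /andP[h1 h2].
apply: (@le_trans _ _ (f (c i) x)); last by lra.
apply: local_inf_le; rewrite -(subrK w (c j)) -addrA.
by rewrite (le_lt_trans (ler_normD _ _))// -ltrBrDl.
Qed.

Lemma local_inf_bound j k x : `|local_inf j k x| <= zeta x.
Proof.
rewrite ler_norml; apply/andP; split.
  by apply: le_local_inf => i _; have := fbound x (cS i); rewrite ler_norml => /andP[].
apply: (@le_trans _ _ (f (c j) x)).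
  by apply: local_inf_le; rewrite subrr normr0 invr_gt0.
by have := fbound x (cS j); rewrite ler_norml => /andP[].
Qed.

(** As [w] lies in each ball, the infima do not exceed [f w x]; once the radius is below [r / 2],
    the ball lies within the continuity radius [r] of [w]. *)
Lemma local_inf_cvg w x (j_ : nat -> nat) : S w ->
  (forall k, `|w - c (j_ k)| < k.+1%:R^-1) ->
  local_inf (j_ k) k x @[k --> \oo] --> f w x.
Proof.
move=> Sw hj; apply/cvgrPdist_le => e e0.
have [r r0 hr] := within_dist x Sw e0.
have hk : \forall k \near \oo, k.+1%:R^-1 < r / 2 :> R.
  by have /cvgr_lt := @cvg_harmonic R; apply; rewrite divr_gt0.
near=> k; rewrite ler_distl; apply/andP; split.
  apply: (@le_trans _ _ (f w x)); last by [].
  rewrite lerBlDr; apply: (@le_trans _ _ (f w x)); last by rewrite lerDl ltW.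
  by apply: local_inf_lower_bound => //; rewrite distrC.
rewrite -lerBlDr; apply: le_local_inf => i hi.
have : `|w - c i| < r.
  rewrite -(subrK (c (j_ k)) w) -addrA (le_lt_trans (ler_normD _ _))//.
  have kr : k.+1%:R^-1 < r / 2 by near: k.
  by rewrite [r]splitr ltrD// (lt_trans _ kr).
by move=> /(hr _ (cS i)); rewrite ltr_distl => /andP[? ?]; lra.
Unshelve. all: by end_near. Qed.

End local_infimum.

Lemma measurable_local_inf d (X : measurableType d) (R : realType)
    (W : normedModType R) (S : set W) (f : W -> X -> R) (zeta : X -> R)
    (c : nat -> W) j k :
  (forall w x, S w -> `|f w x| <= zeta x) -> (forall i, S (c i)) ->
  (forall i, measurable_fun setT (f (c i))) ->
  measurable_fun setT (local_inf f c j k).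
Proof.
move=> fbound cS mf.
apply: (@measurable_fun_infs _ _ _ setT (fun i x => nearby_values f c j k x i) 0).
  move=> x _; exists (- zeta x) => _ [i _ <-].
  rewrite /nearby_values; case: ifP => _.
    by have := fbound _ x (cS i); rewrite ler_norml => /andP[].
  by have := fbound _ x (cS j); rewrite ler_norml => /andP[].
by move=> i; rewrite /nearby_values; case: (`|c j - c i| < k.+1%:R^-1).
Qed.

(** * Almost sure epi-convergence of the sample averages and conclusion *)

Unset Implicit Arguments.

Theorem theorem3p5
  (R : realType)
  (* U: separable Hilbert space *)
  (U : completeNormedModType R) (inner : U -> U -> R)
  (hU : hilbert_inner inner) (sepU : separable_space U)
  (* W: separable Banach space, B compact linear *)
  (W : completeNormedModType R) (sepW : separable_space W)
  (B : {linear U -> W}) (cB : compact_operator B)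
  (* psi proper, closed, convex, [0,oo]-valued, bounded domain *)
  (psi : U -> \bar R)
  (psi_ge0 : forall u, (0 <= psi u)%E)
  (psi_proper : exists u, (psi u < +oo)%E)
  (psi_closed : lower_semicontinuous psi)
  (psi_convex : convex_efun psi)
  (psi_bdd : bounded_set (edom psi))
  (* U0 open convex bounded containing dom psi *)
  (U0 : set U) (oU0 : open U0) (cU0 : convex_set U0) (bU0 : bounded_set U0)
  (domU0 : edom psi `<=` U0)
  (* Xi complete separable metric space with its Borel sigma-field *)
  (Xi : completePseudoMetricType R) (hXi : hausdorff_space Xi)
  (sepXi : separable_space Xi)
  (* complete probability space *)
  (d : measure_display) (Om : measurableType d) (P : probability Om R)
  (Pcompl : measure_is_complete P)
  (* random element xi and i.i.d. sample xis 0, xis 1, ... (= xi^1, xi^2, ...) *)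
  (xi : Om -> g_sigma_algebraType (@open Xi))
  (mxi : measurable_fun setT xi)
  (xis : nat -> Om -> g_sigma_algebraType (@open Xi))
  (mxis : forall i, measurable_fun setT (xis i))
  (indep : mutually_independent P xis)
  (idist : forall i, same_distribution P (xis i) xi)
  (* integrand f *)
  (f : W -> g_sigma_algebraType (@open Xi) -> R)
  (fcont : forall x, {within B @` edom psi, continuous (fun w => f w x)})
  (fmeas : forall w, (B @` U0) w -> measurable_fun setT (f w))
  (zeta : g_sigma_algebraType (@open Xi) -> R)
  (zeta_ge0 : forall x, 0 <= zeta x)
  (mzeta : measurable_fun setT zeta)
  (izeta : P.-integrable setT (fun om => (zeta (xi om))%:E))
  (fbound : forall u x, U0 u -> `|f (B u) x| <= zeta x)
  (* measurable SAA solutions, for every sample size N >= 1 *)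
  (ustar : nat -> Om -> U)
  (mustar : forall N, (0 < N)%N -> borel_measurable_map (ustar N))
  (solves : forall N, (0 < N)%N -> forall om u,
     (saa_obj f xis B psi N om (ustar N om) <= saa_obj f xis B psi N om u)%E) :
  let G := objG P f xi B psi in
  let theta := ereal_inf (range G) in
  let hattheta N om := ereal_inf (range (saa_obj f xis B psi N om)) in
  {ae P, forall om, hattheta N om @[N --> \oo] --> theta} /\
  {ae P, forall om,
     (exists x, weak_acc_point inner (ustar ^~ om) x) /\
     (forall x, weak_acc_point inner (ustar ^~ om) x -> forall u, (G x <= G u)%E)}.
Proof.
move=> G theta hattheta.
pose X : measurableType _ := g_sigma_algebraType (@open Xi).
pose xi' : {mfun Om >-> X} := HB.pack xi (isMeasurableFun.Build _ _ _ _ _ mxi).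
pose xis' i : {mfun Om >-> X} :=
  HB.pack (xis i) (isMeasurableFun.Build _ _ _ _ _ (mxis i)).
pose E (h : X -> R) := Rintegral P setT (fun om => h (xi om)).
pose avg (h : X -> R) N om : R := N%:R^-1 * \sum_(i < N) h (xis i om).
pose S := B @` edom psi.
have [u0 hu0] := psi_proper.
have SU w : S w -> (B @` U0) w by move=> [u hu <-]; exists u => //; exact: domU0.
have fb w x : S w -> `|f w x| <= zeta x.
  by move=> /SU[u hu <-]; exact: fbound.
have mfS w : S w -> measurable_fun setT (f w) by move=> /SU; exact: fmeas.
have iE (h : X -> R) : measurable_fun setT h -> (forall x, `|h x| <= zeta x) ->
    P.-integrable setT (EFin \o (fun om => h (xi om))).
  move=> mh hz; apply: (le_integrable measurableT _ _ izeta).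
    by apply/measurable_EFinP; exact: (measurableT_comp mh mxi).
  by move=> om _ /=; rewrite lee_fin (le_trans (hz _))// ler_norm.
have lln (h : X -> R) : measurable_fun setT h -> (forall x, `|h x| <= zeta x) ->
    {ae P, forall om, avg h N om @[N --> \oo] --> E h}.
  move=> mh hz.
  have := @slln _ _ Om X R P xi' xis' h indep idist mh (iE h mh hz).
  by apply: filterS => om; rewrite /avg; under [in X in _ -> X]eq_fun do rewrite mulrC.
have [c [cS cdense]] := dense_sequence_in sepW (ex_intro S (B u0) (imageP B hu0)).
pose F := expF P f xi.
have FE w : F w = E (f w) by [].
have iz : P.-integrable setT (EFin \o (fun om => zeta (xi om))) by exact: izeta.
(* Together with [psi_ge0] this keeps the optimal value above [-oo]. *)
have Flow w : S w -> - E zeta <= F w.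
  move=> Sw; have iw := iE _ (mfS _ Sw) (fb _ ^~ Sw).
  rewrite FE lerNl -mulN1r -(RintegralZl _ measurableT iw).
  apply: le_Rintegral => //; first exact: (integrableZl measurableT (-1) iw).
  move=> om _; rewrite mulN1r; have := fb w (xi om) Sw.
  by rewrite ler_norml lerNl => /andP[].
have psi_fin u : edom psi u -> psi u \is a fin_num.
  by move=> h; rewrite ge0_fin_numE.
have Gfin u : edom psi u -> G u = (F (B u) + fine (psi u))%:E.
  by move=> h; rewrite /G /objG -[in LHS](fineK (psi_fin _ h)) -EFinD.
have Gdom u : (G u < +oo)%E -> edom psi u.
  move=> h; rewrite /edom /= ltey; apply/eqP => e; move: h.
  by rewrite /G /objG e addey.
have theta_fin : theta \is a fin_num.
  rewrite fin_numElt; apply/andP; split.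
    apply: (@lt_le_trans _ _ (- E zeta)%:E); first exact: ltNyr.
    apply: le_ereal_inf_tmp => _ [u _ <-].
    have [hu|hu] := pselect (edom psi u).
      rewrite (Gfin _ hu) lee_fin -[leLHS]addr0; apply: lerD; last exact: fine_ge0.
      by apply: Flow; exists u.
    have [/Gdom//|] := ltP (G u) +oo%E.
    by rewrite leye_eq => /eqP ->; exact: leey.
  apply: (@le_lt_trans _ _ (G u0)); first by apply: ereal_inf_lbound; exists u0.
  by rewrite (Gfin _ hu0) ltry.
pose th := fine theta.
have thE : theta = th%:E by rewrite /th fineK.
have th_inf x : (th%:E <= (F (B x))%:E + psi x)%E.
  by rewrite -thE; apply: ereal_inf_lbound; exists x.
have /choice[v v_min] : forall j : nat, exists v,
    ((F (B v))%:E + psi v <= (th + j.+1%:R^-1)%:E)%E.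
  move=> j; have j0 : 0 < j.+1%:R^-1 :> R by rewrite invr_gt0.
  have [_ [v _ <-] hv] := lb_ereal_inf_adherent j0 theta_fin.
  by exists v; rewrite EFinD -thE; exact: ltW.
have vdom j : edom psi (v j).
  by apply: Gdom; exact: le_lt_trans (v_min j) (ltry _).
have Sv j : S (B (v j)) by exists (v j).
pose g j k := local_inf f c j k.
have gz j k x : `|g j k x| <= zeta x by exact: (local_inf_bound fb cS).
have mg j k : measurable_fun setT (g j k).
  by apply: (measurable_local_inf _ _ fb cS) => i; exact: mfS.
(* As the balls shrink to [w], dominated convergence with [zeta] gives a pair [j], [k], independent
   of [om], whose infimum has mean at least [F w - e]. *)
have gE w (e : R) : S w -> 0 < e ->
    exists j k, `|w - c j| < k.+1%:R^-1 /\ F w - e <= E (g j k).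
  move=> Sw e0.
  have /choice[j_ hj] : forall k : nat, exists j, `|w - c j| < k.+1%:R^-1.
    by move=> k; apply: cdense => //; rewrite invr_gt0.
  have [] := @dominated_convergence _ _ _ P _ measurableT
    (fun k om => (g (j_ k) k (xi om))%:E) (fun om => (f w (xi om))%:E)
    (fun om => (zeta (xi om))%:E).
  - by move=> k; apply/measurable_EFinP; exact: (measurableT_comp (mg _ _) mxi).
  - by apply/measurable_EFinP; exact: (measurableT_comp (mfS _ Sw) mxi).
  - apply: aeW => om _; apply: cvg_EFin; first exact: nearW.
    exact: (local_inf_cvg fcont fb cS cdense Sw hj).
  - exact: izeta.
  - by apply: aeW => om k _; rewrite lee_fin; exact: gz.
  move=> _ _.
  have -> : (\int[P]_om (f w (xi om))%:E)%E = (F w)%:E.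
    rewrite FE /E /Rintegral fineK// integrable_fin_num//.
    exact: iE (mfS _ Sw) (fb _ ^~ Sw).
  move=> /fine_cvgP[_] /cvgrPdist_le/(_ e e0)[k _ /(_ k (leqnn k))].
  by rewrite ler_distl => /andP[_]; rewrite -lerBlDr => hk; exists (j_ k), k.
(* Only countably many functions are involved, so a single null set serves for all of them. *)
have good : {ae P, forall om, [/\ avg zeta N om @[N --> \oo] --> E zeta,
    forall j, avg (f (B (v j))) N om @[N --> \oo] --> F (B (v j)) &
    forall j k, avg (g j k) N om @[N --> \oo] --> E (g j k)]}.
  have zz x : `|zeta x| <= zeta x by rewrite ger0_norm.
  have l1 := lln zeta mzeta zz.
  have l2 := ae_foralln (fun j => lln _ (mfS _ (Sv j)) (fb _ ^~ (Sv j))).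
  have l3 := ae_foralln (fun j => ae_foralln (fun k => lln _ (mg j k) (gz j k))).
  by apply: filterS3 l1 l2 l3.
have avg_le (h1 h2 : X -> R) N om : (forall x, h1 x <= h2 x) ->
    avg h1 N om <= avg h2 N om.
  by move=> h; rewrite /avg ler_wpM2l ?invr_ge0//; apply: ler_sum.
pose Fh om N w := avg (f w) N om.
have main om : [/\ avg zeta N om @[N --> \oo] --> E zeta,
    forall j, avg (f (B (v j))) N om @[N --> \oo] --> F (B (v j)) &
    forall j k, avg (g j k) N om @[N --> \oo] --> E (g j k)] ->
  [/\ exists K : R, \forall N \near \oo,
        forall w, edom psi w -> `|Fh om N (B w)| <= K,
      forall w (e : R), (B @` edom psi) w -> 0 < e ->
        exists2 r : R, 0 < r & \forall N \near \oo,
        forall w', (B @` edom psi) w' -> `|w - w'| < r -> F w - e <= Fh om N w' &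
      forall j, Fh om N (B (v j)) @[N --> \oo] --> F (B (v j))].
  move=> [zcvg vcvg gcvg]; split => //.
    (* The averages of [zeta] dominate those of [f] and are eventually within 1 of their limit. *)
    exists (E zeta + 1).
    have /cvgrPdist_le/(_ _ ltr01) := zcvg; apply: filterS => N.
    rewrite ler_distlC => /andP[_ hN] w hw; apply: le_trans hN.
    rewrite ler_norml -[X in _ && X]lerN2; apply/andP; split.
      rewrite lerNl -mulrN -sumrN; apply: ler_wpM2l; first by rewrite invr_ge0.
      apply: ler_sum => i _; have := fb (B w) (xis i om) (imageP B hw).
      by rewrite ler_norml lerNl => /andP[].
    rewrite lerN2; apply: avg_le => x.
    by have := fb (B w) x (imageP B hw); rewrite ler_norml => /andP[].
  move=> w e Sw e0; have e20 : 0 < e / 2 by rewrite divr_gt0.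
  have [j [k [jk hF]]] := gE w _ Sw e20.
  (* The ball of this radius around [w] lies inside the ball around [c j], where [g j k] bounds [f]
     from below. *)
  exists (k.+1%:R^-1 - `|w - c j|); first by rewrite subr_gt0.
  have /cvgrPdist_le/(_ _ e20) := gcvg j k; apply: filterS => N.
  rewrite ler_distl => /andP[_ hN] w' Sw' ww'.
  apply: (@le_trans _ _ (avg (g j k) N om)); first by lra.
  apply: avg_le => x; apply: (local_inf_lower_bound fcont fb cS cdense x Sw').
  rewrite -(subrK w (c j)) -addrA (le_lt_trans (ler_normD _ _))//.
  by rewrite distrC -ltrBrDl.
have Hs om N : (0 < N)%N -> forall w,
    ((Fh om N (B (ustar N om)))%:E + psi (ustar N om) <=
     (Fh om N (B w))%:E + psi w)%E by move=> N0 w; exact: solves.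
(* The infimum is attained at the given solution; sample size 0 is excluded, which does not affect
   limits. *)
have hat_val N om : (0 < N)%N ->
    hattheta N om = ((Fh om N (B (ustar N om)))%:E + psi (ustar N om))%E.
  move=> N0; apply/eqP; rewrite eq_le; apply/andP; split.
    by apply: ereal_inf_lbound; exists (ustar N om).
  by apply: le_ereal_inf_tmp => _ [u _ <-]; exact: solves.
split; apply: filterS good => om /main[Hb Hl Hc].
  rewrite thE.
  apply: cvg_trans (epi_cvg_optimal_value hU cB psi_ge0 psi_closed psi_convex
    psi_bdd Hb Hl Hc v_min th_inf (Hs om)).
  by apply: near_eq_cvg; exists 1%N => // N /= N0; rewrite hat_val.
split.
  exact: (epi_cvg_weak_acc_point hU sepU psi_ge0 psi_bdd v_min
    (Hs om)).
move=> x hx u.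
exact: (epi_cvg_minimizer hU cB psi_ge0 psi_closed psi_convex
    psi_bdd Hb Hl Hc v_min th_inf (Hs om) u hx).
Qed.
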